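(* Let $\mathcal{B}$, $\mathbb{P}$ be as in the context and $q\ge1$. The denominator $D(\mathcal{B}^q,\mathcal{A}_{\mathbb{P}}^q)$ of the inside-out polytope equals the least common multiple of the denominators of: (1) points on rigid cycles of length at most $q$; (2) points on corner trajectories of length at most $q$ that start at corners; (3) self-crossing points of augmentations of corner trajectories or rigid cycles of length at most $q-1$; and (4) crossing points of augmentations of two distinct corner trajectories or rigid cycles whose lengths sum to at most $q-1$.
   Context: Board: $\mathcal{B}\subset\mathbb{R}^2$ is a convex polygon with rational corner coordinates, interior $\mathcal{B}^\circ$, boundary $\partial\mathcal{B}$; each side lies on a line $\alpha_1x+\alpha_2y=\beta$. Piece: $\mathbb{P}$ is a two-move rider with nonparallel basic moves $\mathbf{m}_1=(c_1,d_1)$, $\mathbf{m}_2=(c_2,d_2)$, each with relatively prime integer coordinates. For $\mathbf{z}=(\mathbf{z}_1,\dots,\mathbf{z}_q)\in\mathbb{R}^{2q}$, the attack equation of type $r$ between $i\neq j$ is the hyperplane $(\mathbf{z}_i-\mathbf{z}_j)\cdot(d_r,-c_r)=0$; $\mathcal{A}_{\mathbb{P}}^q$ is the arrangement of all of them. A fixation is a hyperplane $(\alpha_1,\alpha_2)\cdot\mathbf{z}_i=\beta$ with $\alpha_1x+\alpha_2y=\beta$ the line of a side of $\mathcal{B}$. A vertex of $(\mathcal{B}^q,\mathcal{A}_{\mathbb{P}}^q)$ is a point of $\mathcal{B}^q$ that is the unique common point of some collection of attack equations and fixations. The denominator of a rational point is the lcm of the denominators of its coordinates; $D(\mathcal{B}^q,\mathcal{A}_{\mathbb{P}}^q)$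 is the lcm of the denominators of all vertices. For a point $\mathbf{z}$, $\mathcal{H}(\mathbf{z})$ is the set of attack equations and fixations containing it; the rank of $\mathbf{z}\in\mathbb{R}^{2q}$ is the rank of the linear system $\mathcal{H}(\mathbf{z})$; full rank means rank $2q$. The rank of a finite set $\{\mathbf{p}_1,\dots,\mathbf{p}_k\}$ of distinct points is the rank of $(\mathbf{p}_1,\dots,\mathbf{p}_k)$. Dynamics: for $r\in\{1,2\}$, $s_r:\partial\mathcal{B}\to\partial\mathcal{B}$ sends $\mathbf{b}$ to itself if the line $\{\mathbf{b}+\lambda\mathbf{m}_r\}$ misses $\mathcal{B}^\circ$, and otherwise to the other point where that line meets $\partial\mathcal{B}$. An extended trajectory is a maximal sequence $(\mathbf{b}_i)_{i\in I}$ ($I\subseteq\mathbb{Z}$ an interval, possibly infinite) in $\partial\mathcal{B}$ with $\mathbf{b}_{i+1}=s_{r_i}(\mathbf{b}_i)\ne\mathbf{b}_i$, $r_i\in\{1,2\}$ alternating. A trajectory is a finite consecutive subsequence $[\mathbf{b}_1,\dots,\mathbf{b}_l]$ of distinct points of an extended trajectory; $l$ is its length; it starts at $\mathbf{b}_1$. A cyclical trajectory consists of $p$ consecutive points of an extended trajectory that is periodic with minimal period $p\ge2$; a rigid cycle is a cyclical trajectory whose point set has full rank. A corner trajectory is a trajectory containing a corner of $\mathcal{B}$. The augmentation of $[\mathbf{b}_1,\dots,\mathbf{b}_l]$ adds the preceding point $\mathbf{b}_0$ and following point $\mathbf{b}_{l+1}$ of its extended trajectory, when they exist. A crossing point of two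 such sequences is a point of $\mathcal{B}^\circ$ lying on a segment between consecutive points of each; if the two sequences are the same it is a self-crossing point.
   Formalization: A crossing or self-crossing point is required to be the only common point of the two segments; read literally, every interior point of a segment would be a self-crossing point, including irrational ones, and the claim would fail. *)

(* Defs.v *)
From HB Require Import structures.
From mathcomp Require Import all_boot all_order all_algebra.
From mathcomp Require Import boolp classical_sets reals topology normedtype.

Set Implicit Arguments.
Unset Strict Implicit.
Unset Printing Implicit Defensive.

Import Order.TTheory GRing.Theory Num.Theory.
Import numFieldNormedType.Exports.

Local Open Scope classical_set_scope.
Local Open Scope ring_scope.

Definition dot (R : realType) (u v : R * R) : R := u.1 * v.1 + u.2 * v.2.

Definition boundary (T : topologicalType) (A : set T) : set T :=
  closure A `\` interior A.

Definition segment (R : realType) (a b : R * R) : set (R * R) :=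
  [set a + t *: (b - a) | t in [set t : R | 0 <= t <= 1]].

(** Denominators and least common multiples *)

(* In the divisibility order on nat every set has a least upper bound, which is
   0 when the set contains 0 or is infinite. *)
Definition is_lcm (S : set nat) (d : nat) : Prop :=
  (forall n, S n -> (n %| d)%N) /\
  (forall m, (forall n, S n -> (n %| m)%N) -> (d %| m)%N).

Definition lcm_of (S : set nat) : nat := xget 0%N (is_lcm S).

Lemma lcm_ofP (S : set nat) : is_lcm S (lcm_of S).
Proof.
suff [d Sd] : exists d, is_lcm S d by apply: (xgetPex 0%N); exists d.
have [[m0 [m0_gt0 Sm0]]|noM] :=
  pselect (exists m, (0 < m)%N /\ forall n, S n -> (n %| m)%N); last first.
  exists 0%N; split=> [n _|m Sm]; first exact: dvdn0.
  by case: m Sm => // m Sm; case: noM; exists m.+1.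
pose P m := (0 < m)%N && `[< forall n, S n -> (n %| m)%N >].
have exP : exists m, P m by exists m0; rewrite /P m0_gt0; apply/asboolP.
case: (ex_minnP exP) => d /andP[d_gt0 /asboolP Sd] dmin.
exists d; split=> // m Sm.
have Pg : P (gcdn d m).
  rewrite /P gcdn_gt0 d_gt0; apply/asboolP => n Sn.
  by rewrite dvdn_gcd Sd ?Sm.
suff <- : gcdn d m = d by exact: dvdn_gcdr.
by apply/eqP; rewrite eqn_leq dmin // dvdn_leq // dvdn_gcdl.
Qed.

Lemma is_lcm_unique (S : set nat) (d e : nat) : is_lcm S d -> is_lcm S e -> d = e.
Proof.
move=> [Sd dmin] [Se emin]; apply/eqP.
by rewrite eqn_dvd dmin // emin.
Qed.

(* An irrational number has no positive denominator; it is given denominator 0,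
   so that it is not silently ignored in a least common multiple. *)
Definition denominator (R : realType) (x : R) : nat :=
  xget 0%N [set `|denq r|%N | r in [set r : rat | ratr r = x]].

Definition point_denominator (R : realType) (x : R * R) : nat :=
  lcmn (denominator x.1) (denominator x.2).

Definition config_denominator (R : realType) (q : nat) (z : 'I_q -> R * R) : nat :=
  \big[lcmn/1%N]_(i < q) point_denominator (z i).

(** Boards *)

(* The outward normal of the side running from v to w when the polygon lies to
   the left of the oriented line vw. *)
Definition edge_normal (R : realType) (v w : R * R) : R * R :=
  (w.2 - v.2, - (w.1 - v.1)).

(* A convex polygon is given by its corners in counterclockwise order, indices
   being cyclic; ordS is the cyclic successor. The convexity condition says that
   the remaining corners are strictly to the left of every side. *)
Record board (R : realType) : Type := Board {
  ncorners : nat;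
  corner : 'I_ncorners -> R * R;
  ncorners_gt2 : (2 < ncorners)%N;
  corner_rational : forall i, rational (corner i).1 /\ rational (corner i).2;
  corner_convex : forall i k, k != i -> k != ordS i ->
    dot (edge_normal (corner i) (corner (ordS i))) (corner k) <
    dot (edge_normal (corner i) (corner (ordS i))) (corner i) }.

(* The i-th side lies on the line dot (side_normal B i) z = side_level B i. *)
Definition side_normal (R : realType) (B : board R) (i : 'I_(ncorners B)) : R * R :=
  edge_normal (corner i) (corner (ordS i)).

Definition side_level (R : realType) (B : board R) (i : 'I_(ncorners B)) : R :=
  dot (side_normal i) (corner i).

Definition region (R : realType) (B : board R) : set (R * R) :=
  [set z | forall i, dot (side_normal (B := B) i) z <= side_level i].

Definition is_corner (R : realType) (B : board R) (x : R * R) : Prop :=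
  exists i, x = corner (b := B) i.

(** Two-move riders *)

(* The two basic moves are indexed by bool. *)
Record rider : Type := Rider {
  basic_move : bool -> int * int;
  basic_move_coprime : forall r, coprimez (basic_move r).1 (basic_move r).2;
  basic_move_nonparallel :
    (basic_move false).1 * (basic_move true).2 !=
    (basic_move false).2 * (basic_move true).1 }.

Definition move_vector (R : realType) (P : rider) (r : bool) : R * R :=
  ((basic_move P r).1%:~R, (basic_move P r).2%:~R).

(* (d_r, - c_r) when the move is (c_r, d_r). *)
Definition move_normal (R : realType) (P : rider) (r : bool) : R * R :=
  ((basic_move P r).2%:~R, - (basic_move P r).1%:~R).

(** The inside-out polytope *)

(* inl (p, r) is the attack equation of type r between the pieces p.1 != p.2;
   inr (i, k) is the fixation of piece i on the line of the k-th side. *)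
Definition equation (R : realType) (B : board R) (q : nat) : finType :=
  ({p : 'I_q * 'I_q | p.1 != p.2} * bool + 'I_q * 'I_(ncorners B))%type.

Definition eq_lhs (R : realType) (B : board R) (P : rider) (q : nat)
    (e : equation B q) (z : 'I_q -> R * R) : R :=
  match e with
  | inl (p, r) => dot (z (val p).1 - z (val p).2) (move_normal R P r)
  | inr (i, k) => dot (side_normal k) (z i)
  end.

Definition eq_rhs (R : realType) (B : board R) (q : nat) (e : equation B q) : R :=
  match e with
  | inl _ => 0
  | inr (_, k) => side_level k
  end.

Definition is_vertex (R : realType) (B : board R) (P : rider) (q : nat)
    (z : 'I_q -> R * R) : Prop :=
  (forall i, region B (z i)) /\
  exists E : {set equation B q}, forall w : 'I_q -> R * R,
    (forall e, e \in E -> eq_lhs P e w = eq_rhs e) <-> w = z.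

Definition polytope_denominator (R : realType) (B : board R) (P : rider)
    (q : nat) : nat :=
  lcm_of [set config_denominator z | z in [set z : 'I_q -> R * R | is_vertex B P z]].

Definition equations_at (R : realType) (B : board R) (P : rider) (q : nat)
    (z : 'I_q -> R * R) : {set equation B q} :=
  [set e | eq_lhs P e z == eq_rhs e]%SET.

(* The coefficients of an equation are the values of its left-hand side, which
   is linear, on the standard basis of R^(2q); the q abscissas come first. *)
Definition eq_coefs (R : realType) (B : board R) (P : rider) (q : nat)
    (e : equation B q) : 'rV[R]_(q + q) :=
  row_mx (\row_i eq_lhs P e (fun j => ((j == i)%:R, 0)))
         (\row_i eq_lhs P e (fun j => (0, (j == i)%:R))).

Definition config_rank (R : realType) (B : board R) (P : rider) (q : nat)
    (z : 'I_q -> R * R) : nat :=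
  \rank (\matrix_(k < #|equations_at B P z|) eq_coefs P (enum_val k)).

Definition full_rank (R : realType) (B : board R) (P : rider)
    (t : seq (R * R)) : Prop :=
  config_rank B P (fun i : 'I_(size t) => nth 0 t i) = (2 * size t)%N.

(** The dynamical system *)

Definition move_line (R : realType) (P : rider) (r : bool) (b : R * R) :
    set (R * R) :=
  [set b + l *: move_vector R P r | l in [set: R]].

(* Meaningful only for b on the boundary. *)
Definition s_map (R : realType) (B : board R) (P : rider) (r : bool)
    (b : R * R) : R * R :=
  if `[< move_line P r b `&` interior (region B) = set0 >] then b
  else xget b [set c | move_line P r b c /\ boundary (region B) c /\ c <> b].

(* Only the values of b on I matter. The types r i are those of the steps from
   i to i + 1; an alternating family extends uniquely to all of int. *)
Definition alternating_orbit (R : realType) (B : board R) (P : rider)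
    (I : set int) (b : int -> R * R) : Prop :=
  [/\ (forall i j k, I i -> I k -> i <= j <= k -> I j),
      (forall i, I i -> boundary (region B) (b i))
    & exists r : int -> bool,
        (forall i, r (i + 1) = ~~ r i) /\
        (forall i, I i -> I (i + 1) ->
           b (i + 1) = s_map B P (r i) (b i) /\ b (i + 1) <> b i)].

Definition extended_trajectory (R : realType) (B : board R) (P : rider)
    (I : set int) (b : int -> R * R) : Prop :=
  alternating_orbit B P I b /\
  forall (J : set int) (c : int -> R * R), alternating_orbit B P J c ->
    I `<=` J -> (forall i, I i -> c i = b i) -> J `<=` I.

(* A nonempty finite run of consecutive points of an extended trajectory. *)
Record run (R : realType) (B : board R) (P : rider) : Type := Run {
  run_dom : set int;
  run_pt : int -> R * R;
  run_start : int;
  run_length : nat;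
  run_extended : extended_trajectory B P run_dom run_pt;
  run_length_gt0 : (0 < run_length)%N;
  run_in_dom : forall n, (n < run_length)%N -> run_dom (run_start + n%:Z) }.

Definition run_points (R : realType) (B : board R) (P : rider)
    (T : run B P) : seq (R * R) :=
  [seq run_pt T (run_start T + n%:Z) | n <- iota 0 (run_length T)].

Definition augmentation (R : realType) (B : board R) (P : rider)
    (T : run B P) : seq (R * R) :=
  [seq run_pt T (run_start T - 1 + n%:Z) | n <- iota 0 (run_length T).+2
     & `[< run_dom T (run_start T - 1 + n%:Z) >]].

Definition is_trajectory (R : realType) (B : board R) (P : rider)
    (T : run B P) : Prop := uniq (run_points T).

Definition is_corner_trajectory (R : realType) (B : board R) (P : rider)
    (T : run B P) : Prop :=
  is_trajectory T /\ exists2 x, x \in run_points T & is_corner B x.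

Definition starts_at_corner (R : realType) (B : board R) (P : rider)
    (T : run B P) : Prop := is_corner B (run_pt T (run_start T)).

Definition periodic (A : Type) (b : int -> A) (p : nat) : Prop :=
  forall i, b (i + p%:Z) = b i.

Definition is_cyclical_trajectory (R : realType) (B : board R) (P : rider)
    (T : run B P) : Prop :=
  [/\ run_dom T = setT, (2 <= run_length T)%N,
      periodic (run_pt T) (run_length T)
    & forall p, (0 < p < run_length T)%N -> ~ periodic (run_pt T) p].

Definition is_rigid_cycle (R : realType) (B : board R) (P : rider)
    (T : run B P) : Prop :=
  is_cyclical_trajectory T /\ full_rank B P (run_points T).

(* The two segments are required to meet in x only, so that points of a segment
   shared by both sequences (in particular, by a sequence and itself) are not
   crossing points. *)
Definition crossing_point (R : realType) (B : board R) (s t : seq (R * R))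
    (x : R * R) : Prop :=
  interior (region B) x /\
  exists i j, [/\ (i.+1 < size s)%N, (j.+1 < size t)%N &
    segment (nth 0 s i) (nth 0 s i.+1) `&` segment (nth 0 t j) (nth 0 t j.+1)
      = [set x]].

Definition self_crossing_point (R : realType) (B : board R) (s : seq (R * R))
    (x : R * R) : Prop := crossing_point B s s x.

Definition rigid_cycle_points (R : realType) (B : board R) (P : rider)
    (q : nat) : set (R * R) :=
  [set x | exists T : run B P,
    [/\ is_rigid_cycle T, (run_length T <= q)%N & x \in run_points T]].

Definition corner_start_points (R : realType) (B : board R) (P : rider)
    (q : nat) : set (R * R) :=
  [set x | exists T : run B P,
    [/\ is_corner_trajectory T, starts_at_corner T,
        (run_length T <= q)%N & x \in run_points T]].

Definition self_crossings (R : realType) (B : board R) (P : rider)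
    (q : nat) : set (R * R) :=
  [set x | exists T : run B P,
    [/\ is_corner_trajectory T \/ is_rigid_cycle T, (run_length T <= q.-1)%N
      & self_crossing_point B (augmentation T) x]].

Definition pair_crossings (R : realType) (B : board R) (P : rider)
    (q : nat) : set (R * R) :=
  [set x | exists T1 T2 : run B P,
    [/\ (is_corner_trajectory T1 \/ is_rigid_cycle T1) /\
        (is_corner_trajectory T2 \/ is_rigid_cycle T2),
        run_points T1 <> run_points T2,
        (run_length T1 + run_length T2 <= q.-1)%N
      & crossing_point B (augmentation T1) (augmentation T2) x]].

(* Main.v *)
Require Import Defs.
From HB Require Import structures.
From mathcomp Require Import all_boot all_order all_algebra.
From mathcomp Require Import boolp classical_sets reals topology normedtype.
From mathcomp Require Import zify ring lra.

(** Measure a point z by its two levels z . (d_r, - c_r): an attack of type r is an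
    equality of r-levels.  A point of B^q is a vertex exactly when its set S of
    positions is rigid: no nonzero infinitesimal motion of S preserves the
    equalities of levels and the sides on which the points lie.

    In a rigid S, consider a maximal alternating path c of s_false and s_true among
    the boundary points of S.  A motion of c that slides each point along its side
    and respects the chords extends to all of S, because a boundary point of S on
    a chord through c belongs to c.  If c contains no corner and does not close up,
    its first point can slide freely, which contradicts rigidity; so c contains a
    corner or is a rigid cycle.  A point of S interior to the board must share each
    of its levels with a boundary point of S, and is thus a crossing point.
    Conversely, corner trajectories and rigid cycles are rigid, a crossing point is
    determined by the two chords through it, and spare pieces can be placed on
    occupied points.  So the positions in vertices are exactly the points listed. *)

Set Implicit Arguments.
Unset Strict Implicit.
Unset Printing Implicit Defensive.

Import Order.TTheory GRing.Theory Num.Theory.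
Import numFieldNormedType.Exports.

Local Open Scope classical_set_scope.
Local Open Scope ring_scope.

(** * Levels and sides *)

Section Dot.
Context {R : realType}.
Implicit Types (u v w : R * R) (t : R).

Lemma dotC u v : dot u v = dot v u.
Proof. by rewrite /dot !(mulrC u.1) !(mulrC u.2). Qed.

Lemma dotDr u v w : dot u (v + w) = dot u v + dot u w.
Proof. by rewrite /dot /=; ring. Qed.

Lemma dotNr u v : dot u (- v) = - dot u v.
Proof. by rewrite /dot /=; ring. Qed.

Lemma dotBr u v w : dot u (v - w) = dot u v - dot u w.
Proof. by rewrite dotDr dotNr. Qed.

Lemma dotZr u t v : dot u (t *: v) = t * dot u v.
Proof. by rewrite /dot /= /GRing.scale /=; ring. Qed.

Lemma dot0r u : dot u 0 = 0.
Proof. by rewrite /dot /=; ring. Qed.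

Lemma dotDl u v w : dot (u + v) w = dot u w + dot v w.
Proof. by rewrite dotC dotDr !(dotC w). Qed.

Lemma dotNl u v : dot (- u) v = - dot u v.
Proof. by rewrite dotC dotNr dotC. Qed.

Lemma dotBl u v w : dot (u - v) w = dot u w - dot v w.
Proof. by rewrite dotDl dotNl. Qed.

Lemma dotZl t u v : dot (t *: u) v = t * dot u v.
Proof. by rewrite dotC dotZr dotC. Qed.

Lemma dot0l u : dot 0 u = 0.
Proof. by rewrite dotC dot0r. Qed.

Lemma dotvv_gt0 u : u != 0 -> 0 < dot u u.
Proof.
case: u => a b; rewrite /dot /= -!expr2 => ab_neq0.
rewrite lt_neqAle addr_ge0 ?sqr_ge0 // andbT eq_sym.
apply: contra ab_neq0; rewrite paddr_eq0 ?sqr_ge0 // !sqrf_eq0.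
by move=> /andP[/eqP-> /eqP->].
Qed.

Definition rot90 u : R * R := (- u.2, u.1).

Lemma dot_eq0_rot90 u v : u != 0 -> dot u v = 0 -> exists t, v = t *: rot90 u.
Proof.
move=> u_neq0 uv0; have := dotvv_gt0 u_neq0.
case: u v u_neq0 uv0 => a b [c d] _; rewrite /dot /= => uv0 uu_gt0.
exists ((a * d - b * c) / (a * a + b * b)).
have N0 : a * a + b * b != 0 by rewrite gt_eqF.
have cancelN x y : (a * a + b * b) * (x / (a * a + b * b) * y) = x * y by field.
apply/eqP; rewrite xpair_eqE /= /GRing.scale /=; apply/andP; split; apply/eqP.
  by apply: (mulfI N0); rewrite cancelN -[RHS]addr0 -(mulr0 a) -uv0; ring.
by apply: (mulfI N0); rewrite cancelN -[RHS]addr0 -(mulr0 b) -uv0; ring.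
Qed.

(* In the plane, orthogonality to a common nonzero vector is parallelism. *)
Lemma dot_eq0_trans n m u v : n != 0 -> m != 0 ->
  dot n m = 0 -> dot n u = 0 -> dot m v = 0 -> dot u v = 0.
Proof.
move=> n0 m0 nm nu mv.
have [t ut] := dot_eq0_rot90 n0 nu; have [s ms] := dot_eq0_rot90 n0 nm.
have s0 : s != 0 by apply: contraNneq m0 => s0; rewrite ms s0 scale0r.
move: mv; rewrite ms ut !dotZl => /eqP; rewrite mulf_eq0 (negPf s0) /= => /eqP->.
by rewrite mulr0.
Qed.

End Dot.

(** * The levels of the two moves as coordinates of the plane *)

Section Moves.
Context {R : realType} (P : rider).
Implicit Types (r : bool) (u v : R * R).

Definition level r (z : R * R) : R := dot z (move_normal R P r).

Lemma levelD r u v : level r (u + v) = level r u + level r v.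
Proof. exact: dotDl. Qed.

Lemma levelB r u v : level r (u - v) = level r u - level r v.
Proof. exact: dotBl. Qed.

Lemma levelZ r t u : level r (t *: u) = t * level r u.
Proof. exact: dotZl. Qed.

Lemma level0 r : level r 0 = 0.
Proof. exact: dot0l. Qed.

Lemma level_move r : level r (move_vector R P r) = 0.
Proof. by rewrite /level /dot /=; ring. Qed.

Lemma move_det r : level (~~ r) (move_vector R P r) != 0.
Proof.
have key : ((basic_move P false).1%:~R * (basic_move P true).2%:~R -
  (basic_move P false).2%:~R * (basic_move P true).1%:~R : R) != 0.
  by rewrite -!intrM -intrB intr_eq0 subr_eq0 basic_move_nonparallel.
case: r; apply: contra key => /eqP e; apply/eqP.
  by rewrite -[RHS]oppr0 -e /level /dot /=; ring.
by rewrite -e /level /dot /=; ring.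
Qed.

Lemma move_neq0 r : move_vector R P r != 0.
Proof. by apply: contraNneq (move_det r) => ->; rewrite level0. Qed.

Lemma level_eq0 r u : level r u = 0 -> exists t, u = t *: move_vector R P r.
Proof.
move=> ru; have n0 : move_normal R P r != 0.
  have := move_neq0 r; rewrite !xpair_eqE /= oppr_eq0 /=.
  by rewrite /move_vector andbC.
have [t ut] := dot_eq0_rot90 n0 (etrans (dotC _ _) ru).
by exists t; rewrite ut /rot90 /move_normal /move_vector /= opprK.
Qed.

(** The moves are not parallel, so the two levels are linear coordinates of the plane. Equalities of
    points and velocities are checked level by level. *)
Lemma level_inj u : (forall r, level r u = 0) -> u = 0.
Proof.
move=> u0; have [t ut] := level_eq0 (u0 true).
have := u0 false; rewrite ut levelZ => /eqP; rewrite mulf_eq0 (negPf (move_det true)) orbF.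
by move=> /eqP->; rewrite scale0r.
Qed.

Lemma level_ex (f : bool -> R) : exists u, forall r, level r u = f r.
Proof.
(* Move [r] leaves level [r] alone, so its coefficient is dictated by the other level. *)
pose c r := f (~~ r) / level (~~ r) (move_vector R P r).
exists (c true *: move_vector R P true + c false *: move_vector R P false).
case; rewrite levelD !levelZ level_move mulr0 ?add0r ?addr0 /c /=.
  by rewrite mulfVK // (move_det false).
by rewrite mulfVK // (move_det true).
Qed.

Lemma move_lineE r b c : move_line P r b c <-> level r c = level r b.
Proof.
split=> [[l _ <-]|bc]; first by rewrite levelD levelZ level_move mulr0 addr0.
have [|t ct] := @level_eq0 r (c - b); first by rewrite levelB bc subrr.
by exists t => //; rewrite -ct addrC subrK.
Qed.

Lemma transversal_eq0 r n u : dot n (move_vector R P r) != 0 ->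
  level r u = 0 -> dot n u = 0 -> u = 0.
Proof.
move=> nm /level_eq0[t ->]; rewrite dotZr => /eqP.
by rewrite mulf_eq0 (negPf nm) orbF => /eqP->; rewrite scale0r.
Qed.

Lemma parallel_level0 r n u : n != 0 -> dot n (move_vector R P r) = 0 ->
  dot n u = 0 -> level r u = 0.
Proof.
move=> n0 nm nu; apply: (dot_eq0_trans n0 (move_neq0 r) nm nu).
by rewrite dotC -/(level _ _) dotC -[RHS](level_move r) /level dotC.
Qed.

End Moves.

(** * Sides and corners of a convex polygon *)

Section Board.
Context {R : realType} (B : board R).
Local Notation n := (ncorners B).
Implicit Types (i k l : 'I_n) (z u : R * R).

Lemma ordS_neq k : ordS k != k.
Proof.
apply/negP => /eqP/(congr1 val) /=; have := ncorners_gt2 B; have := ltn_ord k.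
move: (nat_of_ord k) => j jn n2; case: (ltngtP j.+1 n) => jn'; first by rewrite modn_small //; lia.
  by lia.
by rewrite jn' modnn; lia.
Qed.

Lemma ordSS_neq k : ordS (ordS k) != k.
Proof.
apply/negP => /eqP/(congr1 val) /=; have := ncorners_gt2 B; have := ltn_ord k.
move: (nat_of_ord k) => j jn n2; case: (ltngtP j.+1 n) => jn'; last first.
- by rewrite jn' modnn modn_small; lia.
- by lia.
rewrite (modn_small jn'); case: (ltngtP j.+2 n) => jn2; first by rewrite modn_small //; lia.
  by lia.
by rewrite jn2 modnn; lia.
Qed.

Lemma side_corner k : dot (side_normal k) (corner k) = side_level k.
Proof. by []. Qed.

Lemma side_cornerS k : dot (side_normal k) (corner (ordS k)) = side_level k.
Proof. by rewrite /side_level /side_normal /edge_normal /dot /=; ring. Qed.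

Lemma side_corner_lt k i : i != k -> i != ordS k ->
  dot (side_normal k) (corner i) < side_level k.
Proof. exact: corner_convex. Qed.

Lemma side_corner_ltSS k : dot (side_normal k) (corner (ordS (ordS k))) < side_level k.
Proof. by apply: side_corner_lt; [exact: ordSS_neq | exact: ordS_neq]. Qed.

Lemma side_corner_le k i : dot (side_normal k) (corner i) <= side_level k.
Proof.
have [->|ik] := eqVneq i k; first by rewrite side_corner.
have [->|iSk] := eqVneq i (ordS k); first by rewrite side_cornerS.
exact/ltW/side_corner_lt.
Qed.

Lemma side_normal_neq0 k : side_normal k != 0.
Proof.
apply/negP => /eqP n0; have := side_corner_ltSS k.
by rewrite /side_level n0 !dot0l ltxx.
Qed.

Definition side_dir k : R * R := corner (ordS k) - corner k.

Lemma dot_side_dir k : dot (side_normal k) (side_dir k) = 0.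
Proof. by rewrite dotBr side_corner side_cornerS subrr. Qed.

Lemma side_dirP k u : dot (side_normal k) u = 0 -> exists t, u = t *: side_dir k.
Proof.
move=> /(dot_eq0_rot90 (side_normal_neq0 k))[t ->]; exists t; congr (_ *: _).
by rewrite /rot90 /side_normal /edge_normal /side_dir /= opprK;
  case: (corner _) => ? ?; case: (corner _).
Qed.

(** Consecutive sides are not parallel: the first end of side [k] lies strictly inside the next
    side, while the second end lies on it. *)
Lemma adjacent_sides_eq0 k u : dot (side_normal k) u = 0 ->
  dot (side_normal (ordS k)) u = 0 -> u = 0.
Proof.
move=> /side_dirP[t ->]; rewrite dotZr dotBr side_corner => /eqP.
rewrite mulf_eq0 => /orP[/eqP->|]; first by rewrite scale0r.
rewrite subr_eq0 => /eqP e.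
have : dot (side_normal (ordS k)) (corner k) < side_level (ordS k).
  by apply: side_corner_lt; rewrite eq_sym ?ordS_neq ?ordSS_neq.
by rewrite -e ltxx.
Qed.

(** The normals are the side vectors after a quarter turn, and the sides of a closed polygon sum to
    zero. *)
Lemma sum_side_normal : \sum_(k < n) side_normal k = 0.
Proof.
have sumS (f : 'I_n -> R) : \sum_k f (ordS k) = \sum_k f k.
  by rewrite [RHS](reindex_inj (@ordS_inj n)).
have s1 (f : 'I_n -> R * R) : (\sum_k f k).1 = \sum_k (f k).1.
  by apply: (big_morph (fun z : R * R => z.1)).
have s2 (f : 'I_n -> R * R) : (\sum_k f k).2 = \sum_k (f k).2.
  by apply: (big_morph (fun z : R * R => z.2)).
apply: injective_projections; rewrite ?s1 ?s2 /= ?sumrN sumrB.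
  by rewrite (sumS (fun k => (corner k).2)) subrr.
by rewrite (sumS (fun k => (corner k).1)) subrr oppr0.
Qed.

(* The outward normals sum to zero, so a vector that points outwards through no
   side is parallel to all of them. *)
Lemma no_recession u : (forall k : 'I_n, dot (side_normal k) u <= 0) -> u = 0.
Proof.
move=> u_le0; have : \sum_(k < n) dot (side_normal k) u = 0.
  rewrite -[RHS](dot0l u) -sum_side_normal.
  by rewrite (big_morph (fun z => dot z u) (fun x y => dotDl x y u) (dot0l u)).
move/eqP; rewrite -oppr_eq0 -sumrN psumr_eq0; last by move=> k _; rewrite oppr_ge0.
move=> /allP u0; have {}u0 (k : 'I_n) : dot (side_normal k) u = 0.
  by have := u0 k (mem_index_enum _); rewrite oppr_eq0 => /eqP.
have k : 'I_n by case: n (ncorners_gt2 B) => // m _; exact: ord0.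
exact: (adjacent_sides_eq0 (u0 k)).
Qed.

Lemma exit_side u : u != 0 -> exists k : 'I_n, 0 < dot (side_normal k) u.
Proof.
move=> u0; apply: contrapT => noK; case/negP: u0; apply/eqP/no_recession => k.
by rewrite leNgt; apply/negP => ?; apply: noK; exists k.
Qed.

(** Write [z] as [corner k + t *: side_dir k]. The two neighbouring sides confine [t] to the
    interval from 0 to 1. Strictly between, [z] would lie strictly inside side [l], because at least
    one end of side [k] does. *)
Lemma region_two_sides z k l : region B z -> k != l ->
  dot (side_normal k) z = side_level k -> dot (side_normal l) z = side_level l ->
  is_corner B z.
Proof.
move=> Bz kl zk zl.
have [|t zt] := @side_dirP k (z - corner k); first by rewrite dotBr zk side_corner subrr.
have {}zt : z = corner k + t *: side_dir k by rewrite -zt addrC subrK.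
have [t0|t_neq0] := eqVneq t 0; first by exists k; rewrite zt t0 scale0r addr0.
have [t1|t_neq1] := eqVneq t 1.
  by exists (ordS k); rewrite zt t1 scale1r addrC subrK.
have E (m : 'I_n) : dot (side_normal m) z = (1 - t) * dot (side_normal m) (corner k) +
    t * dot (side_normal m) (corner (ordS k)).
  by rewrite zt dotDr dotZr dotBr; ring.
have [p pk] : exists p, ordS p = k by exists (ord_pred k); exact: ord_predK.
have t_ge0 : 0 < t.
  have := Bz p; rewrite E -{1}pk side_cornerS.
  have : dot (side_normal p) (corner (ordS k)) < side_level p.
    by rewrite -pk; exact: side_corner_ltSS.
  move: (dot _ _) (side_level p) t_neq0 => a b t_neq0 ab h; rewrite lt0r t_neq0 /=.
  by rewrite leNgt; apply/negP => ?; nra.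
have t_le1 : 0 < 1 - t.
  have := Bz (ordS k); rewrite E side_corner.
  have : dot (side_normal (ordS k)) (corner k) < side_level (ordS k).
    by apply: side_corner_lt; rewrite eq_sym ?ordS_neq ?ordSS_neq.
  move: (dot _ _) (side_level (ordS k)) => a b ab h; rewrite lt0r subr_eq0 eq_sym t_neq1 /=.
  by rewrite leNgt; apply/negP => ?; nra.
have := side_corner_le l k; have := side_corner_le l (ordS k).
have : dot (side_normal l) (corner k) < side_level l \/
       dot (side_normal l) (corner (ordS k)) < side_level l.
  have [Sl|kSl] := eqVneq k (ordS l).
    right; rewrite Sl; exact: side_corner_ltSS.
  by left; apply: side_corner_lt.
move: zl; rewrite E; move: (dot _ _) (dot _ _) (side_level l) => a b c abc [] h1 h2 h3; nra.
Qed.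

Lemma corner_two_sides z u : is_corner B z ->
  (forall k : 'I_n, dot (side_normal k) z = side_level k -> dot (side_normal k) u = 0) -> u = 0.
Proof.
move=> [i ->] H; apply: (@adjacent_sides_eq0 (ord_pred i)).
  by apply: H; rewrite -{2}(ord_predK i) side_cornerS.
by rewrite ord_predK; exact: H.
Qed.

End Board.

(** * Chords of the board *)

Section Topology.
Context {R : realType} (B : board R).
Local Notation n := (ncorners B).
Implicit Types (k : 'I_n) (z u : R * R).

Lemma dot_continuous (v : R * R) : continuous (dot v).
Proof.
move=> z; apply: cvgD; apply: cvgM; try exact: cvg_cst.
  exact: cvg_fst.
exact: cvg_snd.
Qed.

(** Finitely many strict inequalities that hold at [t = 0] survive for all small [t]. *)
Lemma small_multiples (I : finType) (a d : I -> R) : (forall i, 0 < a i) ->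
  exists2 e, 0 < e & forall t, `|t| < e -> forall i, t * d i < a i.
Proof.
move=> a_gt0.
have : \forall t \near (0 : R), forall i, t * d i < a i.
  apply: (@filter_forall _ _ (fun i t => t * d i < a i) _ (nbhs_filter _)) => i.
  have dc : (fun t : R => t * d i) @ (0 : R) --> 0 * d i.
    by apply: cvgM; [exact: cvg_id | exact: cvg_cst].
  by apply: (cvgr_lt _ dc); rewrite mul0r.
move=> /nbhs_ballP[e /= e0 sub]; exists e => // t te.
by apply: sub; rewrite /ball /= sub0r normrN.
Qed.

Lemma ball_step z (v : R * R) e : 0 < e -> exists2 t, 0 < t & ball z e (z + t *: v).
Proof.
(* Both signs of both coordinates, so that one-sided bounds give bounds on absolute values. *)
move=> e0; pose d (j : bool * bool) := (-1) ^+ j.1 * (if j.2 then v.1 else v.2).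
have [e' e'0 small] := @small_multiples _ (fun=> e) d (fun=> e0).
have te : `|e' / 2| < e' by rewrite ger0_norm; lra.
have {}small := small _ te; exists (e' / 2); first by rewrite divr_gt0.
split; rewrite /ball /= opprD addrA subrr sub0r normrN ltr_norml ltrNl.
  have := small (true, true); have := small (false, true); rewrite /d /= /GRing.scale /=.
  by rewrite expr0 expr1 mul1r mulN1r mulrN => -> ->.
have := small (true, false); have := small (false, false); rewrite /d /= /GRing.scale /=.
by rewrite expr0 expr1 mul1r mulN1r mulrN => -> ->.
Qed.

(** A small step along an outward normal must not leave the region, so an interior point reaches no
    side. Conversely, strict inequalities are open conditions. *)
Lemma interior_regionE z : interior (region B) z <->
  forall k : 'I_n, dot (side_normal k) z < side_level k.
Proof.
split=> [/nbhs_ballP[e /= e0 sub] k|z_lt].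
  have nn := dotvv_gt0 (side_normal_neq0 k).
  have [t t_gt0 /sub/(_ k)] := ball_step z (side_normal k) e0.
  by rewrite dotDr dotZr; apply: lt_le_trans; rewrite ltrDl mulr_gt0.
suff : \forall w \near z, forall k : 'I_n, dot (side_normal k) w < side_level k.
  by apply: filterS => w w_lt k; exact/ltW.
apply: (@filter_forall _ _ (fun k w => dot (side_normal k) w < side_level k) _
  (nbhs_filter _)) => k.
exact: (cvgr_lt _ (@dot_continuous (side_normal k) z)).
Qed.

Lemma closed_region : closed (region B).
Proof.
have -> : region B = \bigcap_(k in [set: 'I_n])
    (dot (side_normal k) @^-1` [set x | x <= side_level k]).
  by apply/seteqP; split=> z Bz k => [_|]; [exact: Bz | exact: (Bz k I)].
apply: closed_bigI => k _; apply: preimage_closed; last exact: closed_le.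
by move=> z _; exact: dot_continuous.
Qed.

Lemma boundaryE z : boundary (region B) z <->
  region B z /\ exists k : 'I_n, dot (side_normal k) z = side_level k.
Proof.
rewrite /boundary -(closure_id _).1; last exact: closed_region.
split=> [[Bz nint]|[Bz [k zk]]]; split => //.
  apply: contrapT => noK; apply: nint; apply/interior_regionE => k.
  by rewrite lt_neqAle Bz andbT; apply/negP => /eqP zk; apply: noK; exists k.
by move=> /interior_regionE/(_ k); rewrite zk ltxx.
Qed.

Lemma interior_sub z : interior (region B) z -> region B z.
Proof. exact: interior_subset. Qed.

Lemma region_cases z : region B z -> interior (region B) z \/ boundary (region B) z.
Proof.
move=> Bz; have [iz|niz] := pselect (interior (region B) z); [by left | right].
by rewrite /boundary -(closure_id _).1 //; exact: closed_region.
Qed.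

Lemma boundary_region z : boundary (region B) z -> region B z.
Proof. by move=> /boundaryE[]. Qed.

Lemma boundary_not_interior z : boundary (region B) z -> ~ interior (region B) z.
Proof. by case. Qed.

(** The exit time is the least time at which the ray meets the line of a side it heads towards;
    [exit_side] provides such a side, and the other sides impose nothing. *)
Lemma ray p u : interior (region B) p -> u != 0 -> exists2 T, 0 < T &
  forall t, 0 <= t -> (region B (p + t *: u) <-> t <= T) /\
                      (interior (region B) (p + t *: u) <-> t < T).
Proof.
move=> /interior_regionE p_lt u0; have [k0 k0_gt0] := exit_side B u0.
pose F (k : 'I_n) := (side_level k - dot (side_normal k) p) / dot (side_normal k) u.
case: (arg_minP F (P := [pred k : 'I_n | 0 < dot (side_normal k) u]) k0_gt0) => k /= k_gt0 kmin.
exists (F k); first by rewrite divr_gt0 // subr_gt0.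
have E (l : 'I_n) t : dot (side_normal l) (p + t *: u) =
   dot (side_normal l) p + t * dot (side_normal l) u by rewrite dotDr dotZr.
have Fle (l : 'I_n) t : 0 < dot (side_normal l) u ->
    (dot (side_normal l) (p + t *: u) <= side_level l) = (t <= F l).
  by move=> l_gt0; rewrite E /F ler_pdivlMr // lerBrDl.
have Flt (l : 'I_n) t : 0 < dot (side_normal l) u ->
    (dot (side_normal l) (p + t *: u) < side_level l) = (t < F l).
  by move=> l_gt0; rewrite E /F ltr_pdivlMr // ltrBrDl.
have neg (l : 'I_n) t : 0 <= t -> dot (side_normal l) u <= 0 ->
    dot (side_normal l) (p + t *: u) < side_level l.
  move=> t_ge0 l_le0; rewrite E; apply: le_lt_trans (p_lt l).
  by rewrite gerDl mulr_ge0_le0.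
move=> t t_ge0; split; split.
- by move=> /(_ k); rewrite Fle.
- move=> tF l; have [l_le0|l_gt0] := leP (dot (side_normal l) u) 0.
    exact/ltW/neg.
  by rewrite Fle //; apply: le_trans tF _; exact: kmin.
- by move=> /interior_regionE/(_ k); rewrite Flt.
- move=> tF; apply/interior_regionE => l.
  have [l_le0|l_gt0] := leP (dot (side_normal l) u) 0; first exact: neg.
  by rewrite Flt //; apply: lt_le_trans tF _; exact: kmin.
Qed.

End Topology.

Lemma segmentC {R : realType} (a b : R * R) : segment a b = segment b a.
Proof.
suff sub (x y : R * R) : segment x y `<=` segment y x by apply/seteqP; split; exact: sub.
move=> _ [t /= /andP[t0 t1] <-]; exists (1 - t); first by rewrite /= subr_ge0 t1 lerBlDr lerDl.
by apply: injective_projections; rewrite /= /GRing.scale /=; ring.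
Qed.

(** * The maps that follow a chord to its other end *)

Section SMap.
Context {R : realType} (B : board R) (P : rider).
Local Notation bd := (boundary (region B)).
Local Notation int := (interior (region B)).
Local Notation s := (s_map B P).
Local Notation lv := (level P).
Implicit Types (r : bool) (a b c p x : R * R).

Lemma chord r p : int p -> exists a c,
  [/\ a <> c, bd a /\ bd c, lv r a = lv r p /\ lv r c = lv r p,
      forall x, bd x -> lv r x = lv r p -> x = a \/ x = c
    & forall x, int x -> lv r x = lv r p -> segment a c x].
Proof.
move=> ip; pose m := move_vector R P r; have m0 : m != 0 := move_neq0 P r.
have [T2 T2_gt0 r2] := ray ip m0.
have [|T1 T1_gt0 r1] := ray (u := - m) ip; first by rewrite oppr_eq0.
have bdP x : bd x <-> region B x /\ ~ int x.
  split=> [bx|[Bx nix]]; first by split; [exact: boundary_region|exact: boundary_not_interior].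
  by case: (region_cases Bx).
pose f t := p + t *: m.
have regP t : region B (f t) <-> - T1 <= t <= T2.
  have [t0|t0] := leP 0 t.
    rewrite (r2 t t0).1; split=> [->|/andP[]//].
    by rewrite andbT; apply: le_trans t0; rewrite oppr_le0 ltW.
  have := (r1 (- t)); rewrite oppr_ge0 (ltW t0) => /(_ isT)[H _].
  move: H; rewrite scalerN scaleNr opprK lerNl -/(f t) => ->.
  split=> [->|/andP[]//]; rewrite /= ltW //; exact: lt_trans t0 _.
have intP t : int (f t) <-> - T1 < t < T2.
  have [t0|t0] := leP 0 t.
    rewrite (r2 t t0).2; split=> [->|/andP[]//].
    by rewrite andbT; apply: lt_le_trans t0; rewrite oppr_lt0.
  have := (r1 (- t)); rewrite oppr_ge0 (ltW t0) => /(_ isT)[_ H].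
  move: H; rewrite scalerN scaleNr opprK ltrNl -/(f t) => ->.
  split=> [->|/andP[]//]; rewrite /=; exact: lt_trans t0 _.
have lvf t : lv r (f t) = lv r p by rewrite levelD levelZ level_move mulr0 addr0.
have onf x : lv r x = lv r p -> exists t, x = f t.
  by move=> /move_lineE[t _ <-]; exists t.
exists (f (- T1)), (f T2); split.
- move=> /addrI/eqP; rewrite -subr_eq0 -scalerBl scaler_eq0 (negPf m0) orbF => /eqP.
  by lra.
- split; apply/bdP; split; rewrite ?regP ?intP; lra.
- by split; exact: lvf.
- move=> x bx /onf[t xt]; move: bx; rewrite xt => /bdP[/regP/andP[t1 t2]].
  rewrite intP => nt; have [->|tT1] := eqVneq t (- T1); first by left.
  have [->|tT2] := eqVneq t T2; first by right.
  by case: nt; rewrite !lt_neqAle t1 t2 tT2 eq_sym tT1.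
move=> x ix /onf[t xt]; move: ix; rewrite xt => /intP/andP[t1 t2].
exists ((t + T1) / (T2 + T1)).
  rewrite /= divr_ge0 ?ler_pdivrMr //=; lra.
have TT : T2 + T1 != 0 by rewrite gt_eqF // addr_gt0.
by apply: injective_projections; rewrite /= /GRing.scale /=; field.
Qed.

(** Stated through levels, so that it visibly depends only on the line of type [r] through [b]. *)
Definition crosses r b := exists2 p, int p & lv r p = lv r b.

Lemma s_map_id r b : ~ crosses r b -> s r b = b.
Proof.
move=> ncr; rewrite /s_map asboolT //; apply/seteqP; split=> // p [/move_lineE pb ip].
by apply: ncr; exists p.
Qed.

(** The line has exactly two boundary points and [b] is one of them, so the choice made in [s_map]
    is forced to be the other. *)
Lemma s_map_chord r b : bd b -> crosses r b ->
  [/\ s r b <> b, bd (s r b), lv r (s r b) = lv r b,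
      forall x, bd x -> lv r x = lv r b -> x = b \/ x = s r b
    & forall x, int x -> lv r x = lv r b -> segment b (s r b) x].
Proof.
move=> bb [p ip pb]; have [a [c [ac [ba bc]]]] := chord r ip; rewrite pb => -[la lc] ends inside.
have sP : [set x | move_line P r b x /\ bd x /\ x <> b] (s r b).
  rewrite /s_map asboolF; last first.
    by move=> /seteqP[/(_ p) h _]; apply: h; split=> //; exact/move_lineE.
  apply: xgetPex; case: (ends b bb erefl) => e.
    by exists c; split; [exact/move_lineE | split=> //; rewrite e => /esym].
  by exists a; split; [exact/move_lineE | split=> //; rewrite e].
case: sP => /move_lineE ls [bs sb].
have := ends _ bs ls; have := ends _ bb erefl => -[e|e] [e'|e'];
  try by case: sb; rewrite e' e.
  by subst a c; split.
subst a c; split=> // x; first by move=> bx /(ends _ bx)[]; [right|left].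
by rewrite segmentC; exact: inside.
Qed.

Lemma crossesP r b : bd b -> crosses r b <-> s r b <> b.
Proof.
move=> bb; split=> [/(s_map_chord bb)[]//|sb]; apply: contrapT => /(@s_map_id r b).
exact: sb.
Qed.

Lemma s_map_boundary r b : bd b -> bd (s r b).
Proof.
move=> bb; have [/(s_map_chord bb)[]//|/s_map_id->//] := pselect (crosses r b).
Qed.

Lemma level_s_map r b : bd b -> lv r (s r b) = lv r b.
Proof.
move=> bb; have [/(s_map_chord bb)[]//|/s_map_id->//] := pselect (crosses r b).
Qed.

Lemma crosses_level r b c : lv r b = lv r c -> crosses r b -> crosses r c.
Proof. by move=> bc [p ip pb]; exists p => //; rewrite pb. Qed.

Lemma s_mapK r b : bd b -> s r (s r b) = b.
Proof.
move=> bb; have [cr|/s_map_id e] := pselect (crosses r b); last by rewrite !e.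
have [sb bs ls ends _] := s_map_chord bb cr.
have [ssb bss lss _ _] := s_map_chord bs (crosses_level (esym ls) cr).
by case: (ends _ bss (etrans lss ls)).
Qed.

(** A common image would share both levels with [b], hence equal [b]. *)
Lemma s_map_types b : bd b -> s false b <> b -> s true b <> s false b.
Proof.
move=> bb sb e; apply: sb; apply/eqP; rewrite -subr_eq0; apply/eqP/(@level_inj _ P).
by case; rewrite levelB ?level_s_map ?subrr // -e level_s_map // subrr.
Qed.

(** If the move were parallel to the side, its whole line through [b] would stay on the line of the
    side, which misses the interior. *)
Lemma crosses_transversal r b k : dot (side_normal (B := B) k) b = side_level k ->
  crosses r b -> dot (side_normal k) (move_vector R P r) != 0.
Proof.
move=> bk [p /interior_regionE/(_ k) pk /esym/move_lineE[l _ e]].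
apply: contraTneq pk => nm; move: bk; rewrite -e dotDr dotZr nm mulr0 addr0 => ->.
by rewrite ltxx.
Qed.

Lemma noncorner_side_unique b k l : bd b -> ~ is_corner B b ->
  dot (side_normal (B := B) k) b = side_level k ->
  dot (side_normal l) b = side_level l -> k = l.
Proof.
move=> /boundary_region Bb nc bk bl; apply/eqP; apply: contrapT => /negP kl.
exact: nc (region_two_sides Bb kl bk bl).
Qed.

(** Converse of [crosses_transversal] away from corners: [k] is the only side through [b], so a
    short step along the move, inwards through [k], lands in the interior. *)
Lemma noncorner_crosses r b k : bd b -> ~ is_corner B b ->
  dot (side_normal (B := B) k) b = side_level k ->
  dot (side_normal k) (move_vector R P r) != 0 -> crosses r b.
Proof.
move=> bb nc bk; set m := move_vector R P r => nm.
(* The slack at every other side; the value 1 at [k] is a mere positive filler, since that side is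
   settled by the sign of [t]. *)
pose a l := if l == k then 1 else side_level l - dot (side_normal l) b.
have a_gt0 l : 0 < a l.
  rewrite /a; case: eqVneq => // lk; rewrite subr_gt0 lt_neqAle boundary_region // andbT.
  by apply/negP => /eqP bl; rewrite (noncorner_side_unique bb nc bk bl) eqxx in lk.
have [e e0 small] := small_multiples (fun l => dot (side_normal l) m) a_gt0.
pose t := - Num.sg (dot (side_normal k) m) * (e / 2).
have te : `|t| < e.
  by rewrite normrM normrN normr_sg nm mul1r ger0_norm; lra.
exists (b + t *: m); last by rewrite levelD levelZ level_move mulr0 addr0.
apply/interior_regionE => l; rewrite dotDr dotZr.
have [->|lk] := eqVneq l k.
  rewrite bk gtrDl /t !mulNr oppr_lt0 mulrAC mulr_gt0 ?divr_gt0 //.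
  by rewrite -normrEsg normr_gt0.
by have := small t te l; rewrite /a (negPf lk) ltrBrDl.
Qed.

(** With no chord of type [r] at [b], the side is parallel to the move, and sliding along it keeps
    the level. *)
Lemma noncorner_tangent r b k u : bd b -> ~ is_corner B b -> ~ crosses r b ->
  dot (side_normal (B := B) k) b = side_level k -> dot (side_normal k) u = 0 -> lv r u = 0.
Proof.
move=> bb nc ncr bk; apply: parallel_level0; first exact: side_normal_neq0.
apply/eqP; apply: contrapT => /negP nm.
exact: ncr (noncorner_crosses bb nc bk nm).
Qed.

End SMap.

(** * Infinitesimal rigidity *)

Section Rigidity.
Context {R : realType} (B : board R) (P : rider).
Local Notation lv := (level P).
Local Notation nrm := (side_normal (B := B)).
Implicit Types (S : seq (R * R)) (d : R * R -> R * R).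

(* An infinitesimal motion of the points of S that preserves, to first order,
   every attack equation and every fixation holding among them. *)
Definition flex S d : Prop :=
  (forall r a b, a \in S -> b \in S -> lv r a = lv r b -> lv r (d a) = lv r (d b)) /\
  (forall k a, a \in S -> dot (nrm k) a = side_level k -> dot (nrm k) (d a) = 0).

Definition rigid S : Prop := forall d, flex S d -> forall a, a \in S -> d a = 0.

Lemma sub_flex S S' d : {subset S' <= S} -> flex S d -> flex S' d.
Proof.
move=> sub [dl ds]; split=> [r a b /sub aS /sub bS|k a /sub aS]; first exact: dl.
exact: ds.
Qed.

Section Config.
Context (q : nat).
Implicit Types (z u : 'I_q -> R * R) (e : equation B q).

Lemma eq_lhs_sum (I : finType) (F : I -> 'I_q -> R * R) e :
  eq_lhs P e (fun j => \sum_i F i j) = \sum_i eq_lhs P e (F i).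
Proof.
case: e => [[p r]|[i k]] /=.
  rewrite -sumrB.
  by rewrite (big_morph (fun x => dot x (move_normal R P r))
    (fun x y => dotDl x y _) (dot0l _)).
by rewrite (big_morph _ (dotDr _) (dot0r _)).
Qed.

Lemma eq_lhsD e z u :
  eq_lhs P e (fun j => z j + u j) = eq_lhs P e z + eq_lhs P e u.
Proof.
by case: e => [[p r]|[i k]] /=; rewrite ?dotBl ?dotDl ?dotDr //; ring.
Qed.

Lemma eq_lhsZ e t z : eq_lhs P e (fun j => t *: z j) = t * eq_lhs P e z.
Proof.
by case: e => [[p r]|[i k]] /=; rewrite ?dotBl ?dotZl ?dotZr //; ring.
Qed.

(** Expanding a configuration in the standard basis identifies the kernel of the coefficient matrix
    with the solutions of the homogeneous equations. *)
Lemma eq_coefsE e (v : 'rV[R]_(q + q)) :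
  (v *m (eq_coefs P e)^T) 0 0 =
  eq_lhs P e (fun i => (v 0 (lshift q i), v 0 (rshift q i))).
Proof.
rewrite mxE big_split_ord /=.
have -> : (fun i => (v 0 (lshift q i), v 0 (rshift q i))) =
    (fun j => \sum_i v 0 (lshift q i) *: ((j == i)%:R, 0 : R) +
              \sum_i v 0 (rshift q i) *: (0 : R, (j == i)%:R)).
  apply/funext => j; rewrite (bigD1 j) //= [X in _ + X](bigD1 j) //= eqxx !big1 ?addr0.
  - by apply: injective_projections; rewrite /= /GRing.scale /=; ring.
  - by move=> i ij; rewrite eq_sym (negPf ij) (_ : (0, _) = 0) ?scaler0.
  - by move=> i ij; rewrite eq_sym (negPf ij) (_ : (_, 0) = 0) ?scaler0.
rewrite eq_lhsD !eq_lhs_sum; congr (_ + _); apply: eq_bigr => i _.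
  by rewrite eq_lhsZ mxE /eq_coefs row_mxEl mxE.
by rewrite eq_lhsZ mxE /eq_coefs row_mxEr mxE.
Qed.

Lemma equations_atP z e : e \in equations_at B P z <-> eq_lhs P e z = eq_rhs e.
Proof. by rewrite inE; split=> [/eqP|->]. Qed.

Lemma flex_config S z d : (forall i, z i \in S) -> flex S d ->
  forall e, e \in equations_at B P z -> eq_lhs P e (fun i => d (z i)) = 0.
Proof.
move=> zS [dl ds] [[p r]|[i k]] /equations_atP /=; last exact: ds.
rewrite !dotBl => /eqP; rewrite subr_eq0 => /eqP h; apply/eqP; rewrite subr_eq0; apply/eqP.
exact: dl.
Qed.

(** A flex gives velocities to positions, whereas [u] gives them to pieces. Pieces on the same point
    attack each other in both types, which forces equal velocities, so [u] descends to positions. *)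
Lemma rigid_config S z u : (forall i, z i \in S) ->
  (forall a, a \in S -> exists i, a = z i) -> rigid S ->
  (forall e, e \in equations_at B P z -> eq_lhs P e u = 0) -> forall i, u i = 0.
Proof.
move=> zS Sz rS uE.
have ul r i j : lv r (z i) = lv r (z j) -> lv r (u i) = lv r (u j).
  have [->//|ij] := eqVneq i j => zij.
  have := uE (inl (exist (fun p : 'I_q * 'I_q => p.1 != p.2) (i, j) ij, r)).
  rewrite equations_atP /= !dotBl => h; apply/eqP; rewrite -subr_eq0; apply/eqP/h.
  by apply/eqP; rewrite subr_eq0; apply/eqP.
have uz i j : z i = z j -> u i = u j.
  move=> zij; apply/eqP; rewrite -subr_eq0; apply/eqP/(@level_inj _ P) => r.
  by apply/eqP; rewrite levelB subr_eq0; apply/eqP/ul; rewrite zij.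
pose d a := if [pick i | z i == a] is Some i then u i else 0.
have dz i : d (z i) = u i.
  by rewrite /d; case: pickP => [j /eqP/uz|/(_ i)] //; rewrite eqxx.
move=> i; rewrite -dz; apply: rS; last exact: zS.
split=> [r a b /Sz[j ->] /Sz[l ->]|k a /Sz[j ->]]; first by rewrite !dz; exact: ul.
by rewrite dz => zk; apply: (uE (inr (j, k))); rewrite equations_atP.
Qed.

(** Adding a flex to [z] preserves all equations at [z], so uniqueness makes it zero. Conversely,
    take all equations at [z]: the difference of two solutions is a homogeneous solution, hence zero
    by rigidity. *)
Lemma vertexP z : is_vertex B P z <-> (forall i, region B (z i)) /\ rigid (codom z).
Proof.
split=> [[Bz [E Ez]]|[Bz rz]]; split=> //.
  move=> d fd _ /codomP[i ->].
  suff /(congr1 (fun w => w i)) : (fun j => z j + d (z j)) = z.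
    by move/eqP; rewrite -[X in _ == X]addr0 => /eqP/addrI.
  apply/Ez => e eE; have ze : eq_lhs P e z = eq_rhs e by exact: (Ez z).2.
  rewrite eq_lhsD ze (flex_config _ fd) ?addr0 // => [j|]; first exact: codom_f.
  exact/equations_atP.
exists (equations_at B P z) => w; split=> [wE|-> e /equations_atP//].
apply/funext => i; apply/eqP; rewrite -subr_eq0; apply/eqP; move: i.
apply: (rigid_config (codom_f z) _ rz) => [a /codomP//|e eE].
have -> : (fun i => w i - z i) = (fun i => w i + (-1) *: z i).
  by apply/funext => i; rewrite scaleN1r.
by rewrite eq_lhsD eq_lhsZ wE // (equations_atP z e).1 // mulN1r subrr.
Qed.

Lemma config_rankP z : config_rank B P z = (2 * q)%N <->
  (forall u, (forall e, e \in equations_at B P z -> eq_lhs P e u = 0) -> forall i, u i = 0).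
Proof.
rewrite /config_rank -mxrank_tr mul2n -addnn.
set M := (_^T); have ME (v : 'rV_(q + q)) : v *m M = 0 <->
    forall e, e \in equations_at B P z ->
      eq_lhs P e (fun i => (v 0 (lshift q i), v 0 (rshift q i))) = 0.
  have vM k : (v *m M) 0 k = (v *m (eq_coefs P (enum_val k))^T) 0 0.
    by rewrite !mxE; apply: eq_bigr => j _; rewrite !mxE.
  split=> [vM0 e eE|uE].
    by rewrite -eq_coefsE -(enum_rankK_in eE eE) -vM vM0 mxE.
  by apply/rowP => k; rewrite vM eq_coefsE uE ?mxE // enum_valP.
split=> [rM u uE|uE].
  have fM : row_free M by rewrite /row_free rM.
  pose v : 'rV_(q + q) := row_mx (\row_i (u i).1) (\row_i (u i).2).
  have uv : (fun i => (v 0 (lshift q i), v 0 (rshift q i))) = u.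
    by apply/funext => i; rewrite row_mxEl row_mxEr !mxE; case: (u i).
  have /ME/eqP : forall e, e \in equations_at B P z ->
      eq_lhs P e (fun i => (v 0 (lshift q i), v 0 (rshift q i))) = 0.
    by rewrite uv.
  rewrite mulmx_free_eq0 // => /eqP v0 i.
  by rewrite -uv v0 !mxE.
have /eqP// : row_free M.
apply: inj_row_free => v /ME/uE u0; apply/rowP => j.
by case: (splitP j) => i ji; have := u0 i => -[h1 h2]; rewrite mxE;
  [rewrite -h1 | rewrite -h2]; congr (v _ _); exact: val_inj.
Qed.

End Config.

Lemma full_rankP S : full_rank B P S <-> rigid S.
Proof.
rewrite /full_rank config_rankP.
set z := (fun i => _).
have zS i : z i \in S by exact: mem_nth.
have Sz a : a \in S -> exists i, a = z i.
  by move=> /(nthP 0)[i iS <-]; exists (Ordinal iS).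
split=> [h d fd _ /Sz[i ->]|rS u]; last exact: rigid_config.
exact: (h (fun i => d (z i)) (flex_config zS fd)).
Qed.

Lemma rigid_vertex S (q : nat) x : (0 < size S <= q)%N -> rigid S ->
  (forall a, a \in S -> region B a) -> x \in S ->
  exists z : 'I_q -> R * R, is_vertex B P z /\ exists i, z i = x.
Proof.
move=> /andP[S0 Sq] rS BS xS.
(* The default value places all spare pieces on the first point of [S]. *)
pose z (i : 'I_q) := nth (nth 0 S 0) S i.
have zS i : z i \in S.
  rewrite /z; case: (ltnP i (size S)) => iS; first exact: mem_nth.
  by rewrite nth_default //; exact: mem_nth.
have Sz a : a \in S -> exists i, z i = a.
  move=> /(nthP (nth 0 S 0))[i iS <-].
  by exists (Ordinal (leq_trans iS Sq)).
exists z; split; last exact: Sz.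
apply/vertexP; split=> [i|d fd _ /codomP[i ->]]; first exact: BS.
apply: rS (zS i); apply: sub_flex fd => a /Sz[j <-]; exact: codom_f.
Qed.

End Rigidity.

(** * Rigidity of corner trajectories and crossing points *)

Lemma range_propagate (Q : nat -> Prop) (l i : nat) :
  (forall n, (n.+1 < l)%N -> (Q n <-> Q n.+1)) -> (i < l)%N -> Q i ->
  forall n, (n < l)%N -> Q n.
Proof.
move=> QS il Qi.
have Q0 : Q 0%N by elim: i il Qi => // i IH il /(QS i il); apply: IH; exact: ltnW.
by elim=> // n IH nl; apply/(QS n nl)/IH/ltnW.
Qed.

Section RunRigidity.
Context {R : realType} (B : board R) (P : rider).
Local Notation lv := (level P).
Local Notation bd := (boundary (region B)).
Local Notation s := (s_map B P).
Implicit Types (S : seq (R * R)) (d : R * R -> R * R) (T : run B P).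

Lemma flex_corner S d a : flex B P S d -> a \in S -> is_corner B a -> d a = 0.
Proof. by move=> [_ ds] aS ca; apply: (corner_two_sides ca) => k; exact: ds. Qed.

(** The point [b] may only slide along its side, which is transversal to the chord, and its level
    along the chord is held by [a]. *)
Lemma flex_chord S d r a b : flex B P S d -> a \in S -> b \in S -> bd b ->
  crosses B P r b -> lv r a = lv r b -> d a = 0 -> d b = 0.
Proof.
move=> [dl ds] aS bS /boundaryE[_ [k bk]] cr ab da.
apply: (transversal_eq0 (crosses_transversal bk cr)); last exact: ds.
by rewrite -(dl r a b) // da level0.
Qed.

Lemma rigid_cat S S' : rigid B P S -> rigid B P S' -> rigid B P (S ++ S').
Proof.
move=> rS rS' d fd a; rewrite mem_cat => /orP[]; [apply: rS | apply: rS'];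
  by apply: sub_flex fd => x xS; rewrite mem_cat xS ?orbT.
Qed.

Lemma rigid_cons S r (x a c : R * R) : rigid B P S -> a \in S -> c \in S ->
  lv r x = lv r a -> lv (~~ r) x = lv (~~ r) c -> rigid B P (x :: S).
Proof.
move=> rS aS cS xa xc d fd.
have dS b : b \in S -> d b = 0.
  by apply: rS; apply: sub_flex fd => y; rewrite inE => ->; rewrite orbT.
move=> b; rewrite inE => /predU1P[->|/dS//]; apply: (@level_inj _ P) => r'.
have inS y : y \in S -> y \in x :: S by rewrite inE => ->; rewrite orbT.
have [->|] := eqVneq r' r.
  by rewrite (fd.1 r x a) ?mem_head ?inS // dS // level0.
case: r' r xa xc => -[] //= xa xc _.
  by rewrite (fd.1 _ x c) ?mem_head ?inS // dS // level0.
by rewrite (fd.1 _ x c) ?mem_head ?inS // dS // level0.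
Qed.

Lemma run_boundary T i : run_dom T i -> bd (run_pt T i).
Proof. by case: (run_extended T) => -[_ h _] _; exact: h. Qed.

Lemma run_step T i : run_dom T i -> run_dom T (i + 1) ->
  exists2 r, crosses B P r (run_pt T i) & run_pt T (i + 1) = s r (run_pt T i).
Proof.
move=> Ti Ti1; case: (run_extended T) => -[_ _ [r [_ h]]] _.
have [e ne] := h i Ti Ti1; exists (r i) => //.
by apply/crossesP; [exact: run_boundary | rewrite -e].
Qed.

Lemma size_run_points T : size (run_points T) = run_length T.
Proof. by rewrite size_map size_iota. Qed.

Lemma mem_run_points T n : (n < run_length T)%N ->
  run_pt T (run_start T + n%:Z) \in run_points T.
Proof.
by move=> nT; apply/mapP; exists n => //; rewrite mem_iota.
Qed.

Lemma run_pointsP T x : x \in run_points T ->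
  exists2 n, (n < run_length T)%N & x = run_pt T (run_start T + n%:Z).
Proof. by move=> /mapP[n]; rewrite mem_iota => /andP[_ nT] ->; exists n. Qed.

Lemma run_points_region T x : x \in run_points T -> region B x.
Proof.
move=> /run_pointsP[n nT ->].
exact/boundary_region/run_boundary/run_in_dom.
Qed.

(** A corner cannot move, and immobility spreads along the chords in both directions. *)
Lemma corner_trajectory_rigid T : is_corner_trajectory T -> rigid B P (run_points T).
Proof.
move=> [_ [x /run_pointsP[i iT ->] cx]] d fd _ /run_pointsP[n nT ->].
pose Q n := d (run_pt T (run_start T + n%:Z)) = 0.
apply: (@range_propagate Q _ i _ iT) nT; last exact: flex_corner fd (mem_run_points iT) cx.
move=> m mT; have mT' := ltnW mT.
have Tm := run_in_dom mT'; have := run_in_dom mT; rewrite /Q -addn1 PoszD addrA => Tm1.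
have [r cr e] := run_step Tm Tm1; have ls := level_s_map P r (run_boundary Tm).
have mp := mem_run_points mT'; have := mem_run_points mT.
rewrite -addn1 PoszD addrA => mp1.
split; apply: (flex_chord (r := r) fd) => //.
- exact: run_boundary.
- by rewrite e; apply: crosses_level cr; rewrite ls.
- by rewrite e ls.
- exact: run_boundary.
- by rewrite e ls.
Qed.

Lemma filter_iota (p : pred nat) l : (forall n, (0 < n <= l)%N -> p n) ->
  [seq n <- iota 0 l.+2 | p n] =
  iota (~~ p 0%N) (p 0%N + l + p l.+1).
Proof.
move=> pl; rewrite -[l.+2]addn1 iotaD -[l.+1]add1n iotaD !filter_cat /= add0n.
have -> : [seq n <- iota 1 l | p n] = iota 1 l.
  by apply/all_filterP/allP => n; rewrite mem_iota => /andP[n0 nl]; apply: pl; rewrite n0.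
by case: (p 0%N) (p l.+1) => -[] /=; rewrite !iotaD /= ?cats0 ?add0n ?add1n ?addn0.
Qed.

(** Index [n] stands for time [run_start T - 1 + n], so the run itself occupies the indices from 1
    to its length. Only the two extreme indices can be missing, and what remains is an interval. *)
Lemma augmentationE T : exists j m : nat,
  [/\ augmentation T = [seq run_pt T (run_start T - 1 + n%:Z) | n <- iota j m],
      (j + m <= (run_length T).+2)%N,
      forall n, (j <= n < j + m)%N -> run_dom T (run_start T - 1 + n%:Z)
    & forall n, (n <= (run_length T).+1)%N -> run_dom T (run_start T - 1 + n%:Z) ->
        (j <= n < j + m)%N].
Proof.
pose p n := `[< run_dom T (run_start T - 1 + n%:Z) >].
have pT n : (0 < n <= run_length T)%N -> p n.
  move=> /andP[n0 nT]; apply/asboolP.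
  rewrite (_ : _ - 1 + _ = run_start T + n.-1%:Z); last by lia.
  by apply: run_in_dom; lia.
have l0 := run_length_gt0 T.
exists (~~ p 0%N : nat), (p 0%N + run_length T + p (run_length T).+1)%N; split.
- by rewrite /augmentation filter_iota.
- by case: (p 0%N); case: (p _.+1) => /=; lia.
- move=> n nj; apply/asboolP; rewrite -/(p n).
  case: (posnP n) nj => [->|n0 h]; first by case: (p 0%N).
  have [nl|nl] := leqP n (run_length T); first by apply: pT; rewrite n0 nl.
  move: h; case pl: (p _.+1) => h; last by case: (p 0%N) h => /=; lia.
  by have -> : n = (run_length T).+1 by case: (p 0%N) h => /=; lia.
- move=> n nl /asboolP; rewrite -/(p n) => pn.
  have p0 : n = 0%N -> p 0%N by move=> n0; rewrite -n0.
  have p1 : n = (run_length T).+1 -> p (run_length T).+1 by move=> n0; rewrite -n0.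
  case: (p 0%N) (p (run_length T).+1) p0 p1 => -[] /= p0 p1; lia.
Qed.

(** Even a step to or from an added point has an end in the run, so its chord is pinned by a point
    of the run. *)
Lemma augmentation_step T i : (i.+1 < size (augmentation T))%N ->
  exists k, [/\ nth 0 (augmentation T) i = run_pt T k,
    nth 0 (augmentation T) i.+1 = run_pt T (k + 1), run_dom T k, run_dom T (k + 1)
    & run_pt T k \in run_points T \/ run_pt T (k + 1) \in run_points T].
Proof.
have [j [m [-> jm dom _]]] := augmentationE T; rewrite size_map size_iota => im.
have l0 := run_length_gt0 T.
exists (run_start T - 1 + (j + i)%:Z).
have e : run_start T - 1 + (j + i)%:Z + 1 = run_start T - 1 + (j + i.+1)%:Z by lia.
rewrite !(nth_map 0%N) ?size_iota ?(ltnW im) // !nth_iota ?(ltnW im) // e.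
split=> //; try by apply: dom; lia.
have [ji|ji] := posnP (j + i)%N.
  right; rewrite (_ : _ - 1 + _ = run_start T + 0%:Z); last by lia.
  by apply: mem_run_points.
left; rewrite (_ : _ - 1 + _ = run_start T + (j + i).-1%:Z); last by lia.
by apply: mem_run_points; lia.
Qed.

Lemma augmentation_nth T (k : int) :
  run_start T - 1 <= k -> k <= run_start T + (run_length T)%:Z - 1 ->
  run_dom T k -> run_dom T (k + 1) ->
  exists i, [/\ (i.+1 < size (augmentation T))%N,
    nth 0 (augmentation T) i = run_pt T k & nth 0 (augmentation T) i.+1 = run_pt T (k + 1)].
Proof.
move=> k1 k2 Tk Tk1; have [j [m [-> jm _ dom]]] := augmentationE T.
pose n := absz (k - (run_start T - 1))%R.
have nk : run_start T - 1 + n%:Z = k by rewrite /n; lia.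
have nk1 : run_start T - 1 + n.+1%:Z = k + 1 by rewrite -nk; lia.
have /andP[n1 n2] : (j <= n < j + m)%N by apply: dom; [lia | rewrite nk].
have /andP[n3 n4] : (j <= n.+1 < j + m)%N by apply: dom; [lia | rewrite nk1].
exists (n - j)%N; rewrite size_map size_iota.
have e1 : ((n - j).+1 < m)%N by lia.
split=> //; rewrite (nth_map 0%N) ?size_iota ?(ltnW e1) // nth_iota ?(ltnW e1) //.
  by rewrite subnKC // nk.
by rewrite addnS subnKC // nk1.
Qed.

Lemma segmentl (a b : R * R) : segment a b a.
Proof. by exists 0; rewrite /= ?lexx ?ler01 // scale0r addr0. Qed.

Lemma level_segment r (a b x : R * R) : lv r a = lv r b -> segment a b x -> lv r x = lv r a.
Proof. by move=> ab [t _ <-]; rewrite levelD levelZ levelB ab subrr mulr0 addr0. Qed.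

(** Two chords that meet in [x] alone have different types, and each has an end in its run; these
    ends determine both levels of [x]. *)
Lemma crossing_levels T1 T2 x : crossing_point B (augmentation T1) (augmentation T2) x ->
  exists r a c, [/\ a \in run_points T1, c \in run_points T2,
    lv r x = lv r a & lv (~~ r) x = lv (~~ r) c].
Proof.
move=> [ix [i [j [/augmentation_step[k [-> -> k1 k1' in1]]
  /augmentation_step[l [-> -> l1 l1' in2]]]]]].
have [r1 cr1 e1] := run_step k1 k1'; have [r2 cr2 e2] := run_step l1 l1'.
have b1 := run_boundary k1; have b2 := run_boundary l1.
have s1 := level_s_map P r1 b1; have s2 := level_s_map P r2 b2.
rewrite e1 e2 => xE.
have [x1 x2] : (segment (run_pt T1 k) (s r1 (run_pt T1 k)) `&`
    segment (run_pt T2 l) (s r2 (run_pt T2 l))) x by rewrite xE.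
have {}x1 := level_segment (esym s1) x1; have {}x2 := level_segment (esym s2) x2.
have [r12|r12] := eqVneq r1 r2.
  (* Chords of equal type through [x] coincide, so the whole chord would be the single point [x],
     and its boundary end would be interior. *)
  exfalso; move: xE x1 x2; rewrite -r12 => xE x1 x2.
  have [_ _ _ ends _] := s_map_chord b1 cr1.
  have ee : segment (run_pt T2 l) (s r1 (run_pt T2 l)) =
      segment (run_pt T1 k) (s r1 (run_pt T1 k)).
    by case: (ends _ b2 (etrans (esym x2) x1)) => ->; rewrite ?s_mapK // segmentC.
  have : [set x] (run_pt T1 k) by rewrite -xE ee setIid; exact: segmentl.
  by move=> xk; move: b1; rewrite xk => /boundary_not_interior.
have {r12} nr : r2 = ~~ r1 by case: r1 r2 r12 {cr1 e1 s1 x1 cr2 e2 s2 x2 xE} => -[].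
have [a ai xa] : exists2 a, a \in run_points T1 & lv r1 x = lv r1 a.
  case: in1 => h; [by exists (run_pt T1 k) | exists (run_pt T1 (k + 1)) => //].
  by rewrite e1 s1.
have [c ci xc] : exists2 c, c \in run_points T2 & lv r2 x = lv r2 c.
  case: in2 => h; [by exists (run_pt T2 l) | exists (run_pt T2 (l + 1)) => //].
  by rewrite e2 s2.
by exists r1, a, c; rewrite -nr.
Qed.

Lemma crossing_rigid S T1 T2 x : rigid B P S -> {subset run_points T1 <= S} ->
  {subset run_points T2 <= S} ->
  crossing_point B (augmentation T1) (augmentation T2) x -> rigid B P (x :: S).
Proof.
move=> rS s1 s2 /crossing_levels[r [a [c [/s1 aS /s2 cS xa xc]]]].
exact: rigid_cons rS aS cS xa xc.
Qed.

Lemma special_run_rigid T : is_corner_trajectory T \/ is_rigid_cycle T ->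
  rigid B P (run_points T).
Proof. by move=> [/corner_trajectory_rigid//|[_ /full_rankP]]. Qed.

(** The pieces occupy the points of the runs; a crossing point takes one further piece, which is why
    the lengths are bounded by [q.-1] there. *)
Lemma special_point_vertex q x :
  (rigid_cycle_points B P q `|` corner_start_points B P q `|`
    self_crossings B P q `|` pair_crossings B P q) x ->
  exists z : 'I_q -> R * R, is_vertex B P z /\ exists i, z i = x.
Proof.
move=> [[[[T [rT Tq xT]]|[T [cT _ Tq xT]]]|[T [rT Tq xT]]]|[T1 [T2 [[r1 r2] _ Tq xT]]]].
- apply: (rigid_vertex (S := run_points T)) => //; last exact: run_points_region.
    by rewrite size_run_points Tq run_length_gt0.
  by apply: special_run_rigid; right.
- apply: (rigid_vertex (S := run_points T)) => //; last exact: run_points_region.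
    by rewrite size_run_points Tq run_length_gt0.
  exact: corner_trajectory_rigid.
- have l0 := run_length_gt0 T.
  apply: (rigid_vertex (S := x :: run_points T)); rewrite ?mem_head //=.
  + by rewrite size_run_points; lia.
  + exact: (crossing_rigid (special_run_rigid rT) _ _ xT).
  + move=> a; rewrite inE => /predU1P[->|]; last exact: run_points_region.
    by apply: interior_sub; case: xT.
- have l1 := run_length_gt0 T1; have l2 := run_length_gt0 T2.
  apply: (rigid_vertex (S := x :: run_points T1 ++ run_points T2)); rewrite ?mem_head //=.
  + by rewrite size_cat !size_run_points; lia.
  + apply: (crossing_rigid _ _ _ xT).
    * by apply: rigid_cat; exact: special_run_rigid.
    * by move=> a aT; rewrite mem_cat aT.
    * by move=> a aT; rewrite mem_cat aT orbT.
  + move=> a; rewrite inE => /predU1P[->|].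
      by apply: interior_sub; case: xT.
    by rewrite mem_cat => /orP[]; exact: run_points_region.
Qed.

End RunRigidity.

(** * Orbits *)

Section Orbit.
Context {R : realType} (B : board R) (P : rider).
Local Notation bd := (boundary (region B)).
Local Notation s := (s_map B P).

(** The type of the step from time [i] to [i + 1]. As each [s_map] is an involution on the boundary,
    the same map undoes this step, which is how [orbit_bwd] goes back in time. *)
Definition step_type (r0 : bool) (i : int) : bool := r0 (+) odd (absz i).

Lemma step_typeS r0 i : step_type r0 (i + 1) = ~~ step_type r0 i.
Proof.
rewrite /step_type; suff -> : odd (absz (i + 1)) = ~~ odd (absz i) by rewrite addbN.
case: i => [n|[|n]] //; first by rewrite -PoszD /= addn1.
by rewrite (_ : Negz n.+1 + 1 = Negz n) /= ?negbK //; lia.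
Qed.

Lemma step_typeP r0 i : step_type r0 (i - 1) = ~~ step_type r0 i.
Proof. by rewrite -[in RHS](subrK 1 i) step_typeS negbK. Qed.

Fixpoint orbit_fwd (r0 : bool) (b0 : R * R) (n : nat) : R * R :=
  if n is m.+1 then s (r0 (+) odd m) (orbit_fwd r0 b0 m) else b0.

Fixpoint orbit_bwd (r0 : bool) (b0 : R * R) (n : nat) : R * R :=
  if n is m.+1 then s (r0 (+) odd n) (orbit_bwd r0 b0 m) else b0.

Definition orbit (r0 : bool) (b0 : R * R) (i : int) : R * R :=
  match i with Posz n => orbit_fwd r0 b0 n | Negz n => orbit_bwd r0 b0 n.+1 end.

(** The function [orbit] is total and runs on past a stall, so the interval of times around 0
    without a stall has to be cut out. *)
Definition orbit_dom (r0 : bool) (b0 : R * R) : set int :=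
  [set i | forall j : int, (0 <= j < i) || (i <= j < 0) ->
     orbit r0 b0 (j + 1) <> orbit r0 b0 j].

Section FixedStart.
Variables (r0 : bool) (b0 : R * R).
Hypothesis bb0 : bd b0.
Local Notation orb := (orbit r0 b0).
Local Notation dom := (orbit_dom r0 b0).
Local Notation typ := (step_type r0).

Lemma orbit_boundary i : bd (orb i).
Proof.
case: i => n; first by elim: n => //= n IH; exact: s_map_boundary.
by rewrite /orbit; elim: n.+1 => //= m IH; exact: s_map_boundary.
Qed.

Lemma orbitS i : orb (i + 1) = s (typ i) (orb i).
Proof.
case: i => [n|n]; first by rewrite -PoszD addn1.
have -> : orb (Negz n + 1) = orbit_bwd r0 b0 n.
  by case: n => // n; rewrite (_ : Negz n.+1 + 1 = Negz n) //; lia.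
rewrite /= s_mapK //.
by elim: n => //= n IH; exact: s_map_boundary.
Qed.

Lemma orbitP i : orb (i - 1) = s (~~ typ i) (orb i).
Proof.
rewrite -[in RHS](subrK 1 i) orbitS subrK -step_typeP s_mapK //.
exact: orbit_boundary.
Qed.

Lemma dom0 : dom 0.
Proof. by move=> j; lia. Qed.

Lemma domS i : dom i -> orb (i + 1) <> orb i -> dom (i + 1).
Proof.
move=> di ne j jP; have [->//|ji] := eqVneq j i.
by apply: di; lia.
Qed.

Lemma domP i : dom i -> orb (i - 1) <> orb i -> dom (i - 1).
Proof.
move=> di ne j jP; have [->|ji] := eqVneq j (i - 1).
  by rewrite subrK => /esym.
by apply: di; lia.
Qed.

Lemma dom_step i : dom i -> dom (i + 1) -> orb (i + 1) <> orb i.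
Proof.
move=> di di1; have [i0|i0] := leP 0 i; [apply: di1 | apply: di]; lia.
Qed.

Lemma orbit_alternating : alternating_orbit B P dom orb.
Proof.
split=> [i j k di dk ijk l lP|i _|].
- have [l0|l0] := leP 0 l; [apply: dk | apply: di]; lia.
- exact: orbit_boundary.
exists typ; split; first exact: step_typeS.
by move=> i di di1; rewrite orbitS; split=> //; rewrite -orbitS; exact: dom_step.
Qed.

Lemma two_types r a : bd a -> s r a = s (~~ r) a -> s r a = a.
Proof.
move=> ba e; apply: contrapT => ne.
case: r e ne => /= e ne; last exact: s_map_types ba ne (esym e).
by rewrite e in ne; exact: s_map_types ba ne e.
Qed.

(** An extension can prolong the domain only by a step that moves, and the orbit would have made
    that step itself. The delicate case is an extension whose types are opposite to those of the
    orbit. *)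
Lemma orbit_extended : extended_trajectory B P dom orb.
Proof.
split; first exact: orbit_alternating.
move=> J c [Jint Jbd [r [rS cS]]] IJ cE.
have up i : dom i -> J (i + 1) -> dom (i + 1).
  move=> di Ji1; apply: domS => //.
  have [ci ne] := cS i (IJ i di) Ji1; rewrite ci cE // in ne.
  rewrite orbitS; have [<-//|rt] := eqVneq (r i) (typ i).
  have {}rt : r i = ~~ typ i by case: (r i) (typ i) rt => -[].
  (* With opposite types, the new step retraces the orbit to time [i - 1], which is thus in the
     domain; the step from there to [i] would then have both types, against [two_types]. *)
  rewrite rt -orbitP in ne; have dp := domP di ne.
  have := cS (i - 1); rewrite subrK => /(_ (IJ _ dp) (IJ _ di))[].
  have -> : r (i - 1) = typ i.
    by have := rS (i - 1); rewrite subrK rt => /negb_inj.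
  rewrite !cE // => e ne'; case: ne; apply/esym; rewrite {1}e.
  apply: two_types; first exact: orbit_boundary.
  by rewrite -e -step_typeP -orbitS subrK.
have down i : dom i -> J (i - 1) -> dom (i - 1).
  move=> di Ji1; apply: domP => //.
  have := cS (i - 1) Ji1; rewrite subrK => /(_ (IJ i di))[ci].
  have := s_mapK P (r (i - 1)) (Jbd _ Ji1); rewrite -ci cE // => <- ne.
  rewrite orbitP; have [<-|rt] := eqVneq (r (i - 1)) (~~ typ i); first by move=> /esym.
  have {}rt : r (i - 1) = typ i by case: (r _) (typ i) rt => -[].
  have ri : r i = ~~ typ i by have := rS (i - 1); rewrite subrK rt.
  rewrite rt -orbitS in ne; have dS := domS di (fun e => ne (esym e)).
  have := cS i (IJ _ di) (IJ _ dS); rewrite ri !cE // => -[e _].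
  case: ne; apply/esym; rewrite orbitS; apply: two_types; first exact: orbit_boundary.
  by rewrite -orbitS.
have J0 : J 0 := IJ 0 dom0.
move=> [n|n].
  elim: n => [_|n IH Jn]; first exact: dom0.
  rewrite (_ : n.+1%:Z = n%:Z + 1) in Jn *; last by lia.
  by apply: up => //; apply: IH; apply: Jint J0 Jn _; lia.
elim: n => [|n IH] Jn; first exact: (down 0 dom0 Jn).
rewrite (_ : Negz n.+1 = Negz n - 1) in Jn *; last by lia.
by apply: down => //; apply: IH; apply: Jint Jn J0 _; lia.
Qed.

Lemma orbit_run (l : nat) : (0 < l)%N -> (forall n, (n < l)%N -> dom n) ->
  exists T : run B P, [/\ run_dom T = dom, run_pt T = orb, run_start T = 0 &
    run_length T = l].
Proof.
move=> l0 dl; have dl' n : (n < l)%N -> dom (0 + n%:Z) by rewrite add0r; exact: dl.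
by exists (Run orbit_extended l0 dl').
Qed.

(** An even [p] makes the step types periodic too, so one return to [b0] repeats in both directions
    of time. *)
Lemma orbit_periodic (p : nat) : ~~ odd p -> orb p = b0 ->
  forall i k : int, orb (i + k * p%:Z) = orb i.
Proof.
move=> pe pb.
have tp i : typ (i + p%:Z) = typ i.
  rewrite /step_type; congr (_ (+) _).
  by lia.
have per i : orb (i + p%:Z) = orb i.
  case: i => n.
    elim: n => [|n IH]; first by rewrite add0r pb.
    have e : n.+1%:Z = n%:Z + 1 by lia.
    by rewrite e addrAC !orbitS tp IH.
  have ind m : orb (- m%:Z + p%:Z) = orb (- m%:Z).
    elim: m => [|m IH]; first by rewrite oppr0 add0r pb.
    have e : - m.+1%:Z = - m%:Z - 1 by lia.
    by rewrite e addrAC !orbitP tp IH.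
  by rewrite NegzE.
have per' (k : nat) i : orb (i + k%:Z * p%:Z) = orb i.
  elim: k i => [|k IH] i; first by rewrite mul0r addr0.
  by rewrite -addn1 PoszD mulrDl mul1r addrA per IH.
move=> i [k|k]; first exact: per'.
by rewrite -(per' k.+1) NegzE mulNr subrK.
Qed.

End FixedStart.

Implicit Types (c : seq (R * R)).

Definition alt_path (r : bool) c : Prop := forall i, (i.+1 < size c)%N ->
  nth 0 c i.+1 = s (r (+) odd i) (nth 0 c i) /\ nth 0 c i.+1 <> nth 0 c i.

(** The orbit of the first point traverses [c]. Any chord at a point of [c] is the orbit's step
    after or before that point, hence a step of the augmentation. *)
Lemma alt_path_run r c : alt_path r c -> (0 < size c)%N -> bd (nth 0 c 0) ->
  exists T : run B P, [/\ run_points T = c, run_pt T (run_start T) = nth 0 c 0,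
    forall i r', (i < size c)%N -> crosses B P r' (nth 0 c i) ->
      exists2 k, (k.+1 < size (augmentation T))%N &
        segment (nth 0 (augmentation T) k) (nth 0 (augmentation T) k.+1) =
        segment (nth 0 c i) (s r' (nth 0 c i))
  & uniq c -> odd (size c).-1 -> s (~~ r) (last 0 c) = nth 0 c 0 ->
      is_cyclical_trajectory T].
Proof.
move=> ac c0 bb0; set b0 := nth 0 c 0 in bb0 *.
have orbc n : (n < size c)%N -> orbit r b0 n = nth 0 c n.
  by elim: n => [//|n IH] nc; rewrite /= (ac n nc).1 -IH // ltnW.
have domc n : (n < size c)%N -> orbit_dom r b0 n.
  elim: n => [|n IH] nc; first exact: dom0.
  rewrite -addn1 PoszD; apply: domS; first exact/IH/ltnW.
  by have nc' := ltnW nc; rewrite -PoszD addn1 !orbc //; exact: (ac n nc).2.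
have [T [Td Tp Ts Tl]] := orbit_run bb0 c0 domc.
exists T; split.
- apply: (@eq_from_nth _ 0); first by rewrite size_run_points.
  rewrite size_run_points Tl => i ic.
  by rewrite (nth_map 0%N) ?size_iota ?Tl // nth_iota // Tp Ts !add0r -orbc // add0n.
- by rewrite Tp Ts.
- move=> i r' ic cr.
  have bi : bd (nth 0 c i) by rewrite -orbc //; exact: orbit_boundary.
  have ne := (crossesP P r' bi).1 cr.
  have [e|e] := eqVneq r' (step_type r i).
    have oS : orbit r b0 (i%:Z + 1) = s r' (nth 0 c i) by rewrite orbitS // -e orbc.
    have [||||k [kT k1 k2]] := @augmentation_nth _ _ _ T i; rewrite ?Ts ?Tl ?Td; try lia.
    + exact: domc.
    + by apply: domS; [exact: domc | rewrite oS orbc].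
    by exists k => //; rewrite k1 k2 Tp oS orbc.
  have {}e : r' = ~~ step_type r i by case: r' (step_type r i) e {cr ne} => -[].
  have oP : orbit r b0 (i%:Z - 1) = s r' (nth 0 c i) by rewrite orbitP // -e orbc.
  have [||||k [kT k1 k2]] := @augmentation_nth _ _ _ T (i%:Z - 1);
    rewrite ?subrK ?Ts ?Tl ?Td; try lia.
  + by apply: domP; [exact: domc | rewrite oP orbc].
  + exact: domc.
  by exists k => //; rewrite k1 k2 subrK Tp oP orbc // segmentC.
move=> uc oc cyc; have c1 : (1 < size c)%N by case: (size c) oc c0 => [//|[]].
have ec : ~~ odd (size c) by case: (size c) c0 oc => //= n _ ->.
(* The last point has odd index, so the next step of the orbit has type [~~ r], the type of the
   closing chord. *)
have orbN : orbit r b0 (size c) = b0.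
  have lc : ((size c).-1 < size c)%N by lia.
  rewrite -[RHS]cyc -nth_last -(orbc _ lc).
  rewrite (_ : (size c)%:Z = (size c).-1%:Z + 1); last by lia.
  by rewrite orbitS // /step_type /= oc addbT.
have per := orbit_periodic bb0 ec orbN.
split; rewrite ?Tl ?Tp //.
- rewrite Td; apply/seteqP; split=> // i _ j _.
  have p0 : (size c)%:Z != 0 by lia.
  have ne m : (m < size c)%N -> orbit r b0 (m%:Z + 1) <> orbit r b0 m.
    move=> mc; have [mc'|mc'] := ltnP m.+1 (size c).
      by rewrite -PoszD addn1 !orbc //; exact: (ac m mc').2.
    have mE : m.+1 = size c by apply/eqP; rewrite eqn_leq mc mc'.
    rewrite -PoszD addn1 mE orbN orbc // => /eqP; rewrite nth_uniq //.
    by rewrite -[m]/(m.+1.-1) mE; lia.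
  (* Reduced modulo the period, every time falls on the path, where no step stalls. *)
  have [m mc [k ->]] : exists2 m, (m < size c)%N & exists k : int, j = m%:Z + k * (size c)%:Z.
    exists (absz (modz j (size c))).
      by have := modz_ge0 j p0; have := ltz_pmod j (d := (size c)%:Z); lia.
    exists (divz j (size c)); rewrite {1}(divz_eq j (size c)) addrC.
    by have := modz_ge0 j p0; lia.
  by rewrite addrAC !per; exact: ne.
- by move=> i; have := per i 1; rewrite mul1r.
move=> p /andP[p0 pc] /(_ 0); rewrite add0r => /=; rewrite -[LHS]/(orbit r b0 p) orbc //.
by move=> /eqP; rewrite nth_uniq //; lia.
Qed.

End Orbit.

(** * Components of a rigid configuration *)

Section Component.
Context {R : realType} (B : board R) (P : rider).
Local Notation lv := (level P).
Local Notation bd := (boundary (region B)).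
Local Notation s := (s_map B P).
Local Notation nrm := (side_normal (B := B)).
Implicit Types (S C c : seq (R * R)) (e : R * R -> R * R).

Definition s_closed S C : Prop := forall a r, a \in C -> s r a \in S -> s r a \in C.

Section Extension.
Variables (S C : seq (R * R)).
Hypotheses (BS : forall a, a \in S -> region B a) (CS : {subset C <= S}).
Hypotheses (Cbd : forall a, a \in C -> bd a) (Cnc : forall a, a \in C -> ~ is_corner B a).
Hypothesis (Ccl : s_closed S C).

Definition chord_flex e : Prop :=
  (forall k a, a \in C -> dot (nrm k) a = side_level k -> dot (nrm k) (e a) = 0) /\
  (forall r a, a \in C -> s r a \in C -> lv r (e a) = lv r (e (s r a))).

Lemma tangent_chord_flex e r a : chord_flex e -> a \in C -> ~ crosses B P r a ->
  lv r (e a) = 0.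
Proof.
move=> [es _] aC ncr; have /boundaryE[_ [k ak]] := Cbd aC.
by apply: (noncorner_tangent (Cbd aC) (Cnc aC) ncr ak); exact: es.
Qed.

(** Distinct boundary points on one level either are the ends of a chord or lie on a side parallel
    to the move; in the second case both velocities have level zero. *)
Lemma chord_flex_level e r a b : chord_flex e -> a \in C -> b \in C ->
  lv r a = lv r b -> lv r (e a) = lv r (e b).
Proof.
move=> fe aC bC ab; have [cr|ncr] := pselect (crosses B P r a); last first.
  rewrite !tangent_chord_flex // => /(@crosses_level _ _ _ _ _ _ (esym ab)).
  exact: ncr.
have [_ _ _ ends _] := s_map_chord (Cbd aC) cr.
case: (ends b (Cbd bC) (esym ab)) => e'; first by rewrite e'.
by rewrite e'; apply: fe.2; rewrite // -e'.
Qed.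

(* Points outside C do not move: a boundary point of S on a chord through a point
   of C is in C. *)
Lemma chord_flex_extend e : chord_flex e ->
  exists2 d, flex B P S d & forall a, a \in C -> d a = e a.
Proof.
move=> fe.
(* Motion is assigned to lines: [u r v] is the velocity of the line of type [r] at level [v], and 0
   for lines that miss [C]. *)
pose U r v := [set w | exists2 a, a \in C & lv r a = v /\ w = lv r (e a)].
pose u r v := xget 0 (U r v).
have uC r a : a \in C -> u r (lv r a) = lv r (e a).
  move=> aC; have [b bC [ba ->]] : U r (lv r a) (u r (lv r a)).
    by apply: xgetPex; exists (lv r (e a)), a.
  exact: chord_flex_level.
have [d dE] : exists d, forall a r, lv r (d a) = u r (lv r a).
  exists (fun a => sval (cid (level_ex P (fun r => u r (lv r a))))) => a.
  by case: cid.
have dC a : a \in C -> d a = e a.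
  move=> aC; apply/eqP; rewrite -subr_eq0; apply/eqP/(@level_inj _ P) => r.
  by rewrite levelB dE uC // subrr.
exists d => //; split=> [r a b _ _ ab|k a aS ak]; first by rewrite !dE ab.
have [aC|aC] := boolP (a \in C); first by rewrite dC //; exact: fe.1.
(* Only points on sides have to stay put; interior points may be carried along by their lines. *)
have ba : bd a by apply/boundaryE; split; [exact: BS | exists k].
rewrite (_ : d a = 0) ?dot0r //; apply: (@level_inj _ P) => r; rewrite dE.
have [[w [b bC [ba' _]]]|noU] := pselect (exists w, U r (lv r a) w); last first.
  by rewrite /u xgetPN // => w Uw; apply: noU; exists w.
rewrite -ba' uC //; have [cr|] := pselect (crosses B P r b); last exact: tangent_chord_flex.
have [_ _ _ ends _] := s_map_chord (Cbd bC) cr.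
case/negP: aC; case: (ends a ba (esym ba')) => e'; first by rewrite e'.
by rewrite e'; apply: Ccl; rewrite -?e'.
Qed.

Lemma rigid_chord_flex e : rigid B P S -> chord_flex e -> forall a, a \in C -> e a = 0.
Proof.
move=> rS /chord_flex_extend[d fd dC] a aC; rewrite -dC //.
exact: rS fd _ (CS aC).
Qed.

Lemma rigid_component : rigid B P S -> rigid B P C.
Proof.
move=> rS e [el es]; apply: rigid_chord_flex => //; split=> // r a aC saC.
by apply: el => //; rewrite level_s_map //; exact: Cbd.
Qed.

End Extension.

Definition tangent (a : R * R) : R * R :=
  xget 0 [set side_dir k | k in [set k | dot (nrm k) a = side_level k]].

Lemma tangentP a : bd a -> ~ is_corner B a ->
  tangent a != 0 /\ forall k, dot (nrm k) a = side_level k -> dot (nrm k) (tangent a) = 0.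
Proof.
move=> ba nc; have [k /= ak <-] :
    [set side_dir k | k in [set k | dot (nrm k) a = side_level k]] (tangent a).
  by apply: xgetPex; have /boundaryE[_ [k ak]] := ba; exists (side_dir k), k.
split; last first.
  by move=> l al; rewrite -(noncorner_side_unique ba nc ak al) dot_side_dir.
apply: contra (side_normal_neq0 k) => /eqP d0.
have e : corner (ordS k) = corner k by apply/eqP; rewrite -subr_eq0 -/(side_dir k) d0.
by rewrite /side_normal /edge_normal e !subrr oppr0.
Qed.

Lemma level_tangent r a : bd a -> ~ is_corner B a -> crosses B P r a ->
  lv r (tangent a) != 0.
Proof.
move=> ba nc cr; have [t0 tk] := tangentP ba nc; have /boundaryE[_ [k ak]] := ba.
apply: contra t0 => /eqP lt0; apply/eqP.
exact: transversal_eq0 (crosses_transversal ak cr) lt0 (tk k ak).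
Qed.

(** * The motion of an alternating path *)

Section Path.
Variables (r0 : bool) (c : seq (R * R)).
Hypotheses (cp : alt_path B P r0 c) (uc : uniq c) (cb : forall a, a \in c -> bd a).
Local Notation N := (size c).-1.
Local Notation p := (nth 0 c).
Local Notation typ i := (r0 (+) odd i).

(** An even number of points makes the types alternate around the whole cycle, including the closing
    chord. *)
Definition closes_up : Prop := odd N /\ s (~~ r0) (p N) = p 0.

Lemma path_boundary i : (i < size c)%N -> bd (p i).
Proof. by move=> ic; apply: cb; rewrite mem_nth. Qed.

Lemma path_prev i : (i.+1 < size c)%N -> s (typ i) (p i.+1) = p i.
Proof. by move=> ic; rewrite (cp ic).1 s_mapK //; apply/path_boundary/ltnW. Qed.

Lemma path_inj i j : (i < size c)%N -> (j < size c)%N -> p i = p j -> i = j.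
Proof. by move=> ic jc /eqP; rewrite nth_uniq // => /eqP. Qed.

(** Both chords at an inner point already lead to its neighbours on the path; only the first point
    has a free chord, of type [~~ r0]. The same reason governs [path_first_return]. *)
Lemma path_last_return j : (j < N)%N -> s (typ N) (p N) = p j -> closes_up.
Proof.
move=> jN e; have Nc : (N < size c)%N by lia.
have jc : (j < size c)%N by lia.
have e' : s (typ N) (p j) = p N by rewrite -e s_mapK //; exact: path_boundary.
have [tj|tj] := eqVneq (odd j) (odd N).
  have jS : (j.+1 < size c)%N by lia.
  move: e'; rewrite -tj -(cp jS).1 => /(path_inj jS Nc) jN'.
  by move: tj; rewrite -jN' /=; case: (odd j).
case: j => [|j] in jN e jc e' tj *.
  have oN : odd N by move: tj => /=; case: (odd N).
  by split=> //; rewrite -e oN addbT.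
have tjN : odd N = odd j by move: tj => /=; case: (odd j); case: (odd N).
move: e'; rewrite tjN path_prev // => /(path_inj (ltnW jc) Nc); lia.
Qed.

Lemma path_first_return j : (0 < j < size c)%N -> s (~~ r0) (p 0) = p j -> closes_up.
Proof.
move=> /andP[j0 jc] e; have c0 : (0 < size c)%N by lia.
have e' : s (~~ r0) (p j) = p 0 by rewrite -e s_mapK //; exact: path_boundary.
have [oj|oj] := boolP (odd j).
  have [jS|jS] := ltnP j.+1 (size c).
    by move: e'; rewrite -addbT -oj -(cp jS).1 => /(path_inj jS c0).
  have jN : j = N by lia.
  by rewrite jN in oj e'; split.
case: j => [//|j] in j0 jc e e' oj *.
move: e'; have <- : typ j = ~~ r0 by move: oj => /=; rewrite negbK => ->; rewrite addbT.
by rewrite path_prev // => /(path_inj (ltnW jc) c0) j00; rewrite j00 in oj.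
Qed.

Section PathFlex.
Hypotheses (cnc : forall a, a \in c -> ~ is_corner B a) (nclose : ~ closes_up).
Hypothesis (c0 : (0 < size c)%N).

Fixpoint path_velocity (n : nat) : R * R :=
  if n is m.+1 then
    (lv (typ m) (path_velocity m) / lv (typ m) (tangent (p n))) *: tangent (p n)
  else tangent (p 0).

Lemma path_velocityP n : exists t, path_velocity n = t *: tangent (p n).
Proof. by case: n => [|n]; [exists 1; rewrite scale1r | eexists; reflexivity]. Qed.

Lemma path_velocity_level n : (n.+1 < size c)%N ->
  lv (typ n) (path_velocity n.+1) = lv (typ n) (path_velocity n).
Proof.
move=> nc; rewrite [path_velocity n.+1]/= levelZ mulfVK //.
have bn := path_boundary nc; apply: level_tangent => //; first by apply: cnc; rewrite mem_nth.
by apply/crossesP => //; rewrite path_prev // => /esym; exact: (cp nc).2.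
Qed.

(* A path that does not close up has one degree of freedom: its first point may
   slide along its side, and the chords transmit the motion. *)
Lemma path_chord_flex : exists2 e, chord_flex c e & e (p 0) != 0.
Proof.
exists (fun a => path_velocity (index a c)); last first.
  rewrite index_uniq //; have := @tangentP (p 0); case=> //; first exact: path_boundary.
  by apply: cnc; rewrite mem_nth.
have vel i : (i < size c)%N -> path_velocity (index (p i) c) = path_velocity i.
  by move=> ic; rewrite index_uniq.
split=> [k a ac ak|r a ac sac].
  have ia : (index a c < size c)%N by rewrite index_mem.
  have [t ->] := path_velocityP (index a c); rewrite nth_index // dotZr.
  by rewrite (tangentP (cb ac) (cnc ac)).2 // mulr0.
have [sa|sa] := eqVneq (s r a) a; first by rewrite sa.
move: ac sa sac => /(nthP 0)[i ic' <-] sa /(nthP 0)[j jc' sj].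
have {ic'} ic : (i < size c)%N := ic'; have {jc'} jc : (j < size c)%N := jc'.
have ij : j <> i by move=> ji; case/eqP: sa; rewrite -sj ji.
(* The chord at [p i] is the next step, the preceding step, or a chord leaving from an end of the
   path, which would close the path up. *)
have [ri|ri] := eqVneq r (typ i).
  have [iS|iN] := ltnP i.+1 (size c).
    by rewrite ri -(cp iS).1 !vel // path_velocity_level.
  have iE : i = N by lia.
  case: nclose; apply: (@path_last_return j); first by lia.
  by rewrite -iE -ri sj.
have {}ri : r = ~~ typ i by move: ri; case: r {sa sj}; case: (typ i).
case: i => [|i] in ic sa sj ij ri *.
  case: nclose; apply: (@path_first_return j); first by lia.
  by rewrite sj ri addbF.
have {}ri : r = typ i by rewrite ri /= addbN negbK.
by rewrite ri path_prev // !vel ?(ltnW ic) // path_velocity_level.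
Qed.

End PathFlex.
End Path.

(** * Maximal alternating paths in a configuration *)

Lemma alt_path_cons r x c : alt_path B P r c -> bd (nth 0 c 0) ->
  x = s (~~ r) (nth 0 c 0) -> x <> nth 0 c 0 -> alt_path B P (~~ r) (x :: c).
Proof.
move=> cp b0 -> ne [|i] ic /=; last by have := cp i ic; rewrite addNb addbN negbK.
by rewrite addbF s_mapK //; split=> // /esym.
Qed.

Lemma alt_path_rcons r x c : alt_path B P r c -> (0 < size c)%N ->
  x = s (r (+) odd (size c).-1) (nth 0 c (size c).-1) -> x <> nth 0 c (size c).-1 ->
  alt_path B P r (rcons c x).
Proof.
move=> cp c0 -> ne i; rewrite size_rcons => ic; rewrite !nth_rcons.
have [iS|iS] := ltnP i.+1 (size c); first by rewrite (ltnW iS); exact: cp.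
have -> : i = (size c).-1 by lia.
by rewrite prednK // eqxx leqnn.
Qed.

Definition component S b r c : Prop :=
  [/\ alt_path B P r c, uniq c, {subset c <= S}, b \in c & forall a, a \in c -> bd a].

(** Take a longest path through [b]. A chord neighbour in [S] but off the path could only hang on an
    end, and attaching it would lengthen the path. *)
Lemma max_component S b : b \in S -> bd b ->
  exists r c, component S b r c /\ s_closed S c.
Proof.
move=> bS bb.
pose Q n := `[< exists r c, component S b r c /\ size c = n >].
have exQ : exists n, Q n.
  exists 1%N; apply/asboolP; exists true, [:: b]; split=> //; split=> //.
  - by move=> a; rewrite inE => /eqP->.
  - by rewrite mem_head.
  - by move=> a; rewrite inE => /eqP->.
have bdQ n : Q n -> (n <= size S)%N.
  by move=> /asboolP[r [c [[_ uc cS _ _] <-]]]; exact: uniq_leq_size.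
case: (ex_maxnP exQ bdQ) => n /asboolP[r [c [[cp uc cS bc cb] cn]]] nmax.
exists r, c; split=> // a r' /(nthP 0)[i ic' <-] sS.
have {ic'} ic : (i < size c)%N := ic'.
apply: contrapT => /negP snc.
have nlt c' r'' : component S b r'' c' -> (size c' <= size c)%N.
  by move=> h; rewrite cn; apply: nmax; apply/asboolP; exists r'', c'.
have bi := path_boundary cb ic.
have ne : s r' (nth 0 c i) <> nth 0 c i.
  by move=> e; rewrite e mem_nth in snc.
have bs : bd (s r' (nth 0 c i)) by exact: s_map_boundary.
have [ri|ri] := eqVneq r' (r (+) odd i).
  have [iS|iN] := ltnP i.+1 (size c).
    by rewrite ri -(cp i iS).1 mem_nth in snc.
  have iE : i = (size c).-1 by lia.
  have := nlt (rcons c (s r' (nth 0 c i))) r; rewrite size_rcons ltnn.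
  case/(_ _)/negP => //; split.
  - by apply: alt_path_rcons => //; rewrite -?iE -?ri //; lia.
  - by rewrite rcons_uniq snc.
  - by move=> x; rewrite mem_rcons inE => /predU1P[->|/cS].
  - by rewrite mem_rcons inE bc orbT.
  - by move=> x; rewrite mem_rcons inE => /predU1P[->|/cb].
have {}ri : r' = ~~ (r (+) odd i) by move: ri; clear; case: r'; case: (r (+) _).
case: i => [|i] in ic sS snc bi ne bs ri *; last first.
  have {}ri : r' = r (+) odd i by rewrite ri /= addbN negbK.
  by rewrite ri (path_prev cp cb) // mem_nth // ltnW in snc.
have := nlt (s r' (nth 0 c 0) :: c) (~~ r); rewrite /= ltnn.
case/(_ _)/negP => //; split=> //=.
- by apply: alt_path_cons => //; rewrite ri addbF.
- by rewrite snc.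
- by move=> x; rewrite inE => /predU1P[->|/cS].
- by rewrite inE bc orbT.
- by move=> x; rewrite inE => /predU1P[->|/cb].
Qed.

Lemma rigid_componentP S b r c : (forall a, a \in S -> region B a) -> rigid B P S ->
  component S b r c -> s_closed S c ->
  (exists2 a, a \in c & is_corner B a) \/
  [/\ closes_up r c, rigid B P c & forall a, a \in c -> ~ is_corner B a].
Proof.
move=> BS rS [cp uc cS bc cb] ccl.
have [|nc] := pselect (exists2 a, a \in c & is_corner B a); [by left | right].
have {}nc a : a \in c -> ~ is_corner B a by move=> ac ca; apply: nc; exists a.
have c0 : (0 < size c)%N by case: c bc {cp uc cS cb ccl nc}.
split=> //; last exact: rigid_component BS cS cb nc ccl rS.
apply: contrapT => ncl; have [e fe] := path_chord_flex cp uc cb nc ncl c0.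
by rewrite (rigid_chord_flex BS cS cb nc ccl rS fe) ?eqxx // mem_nth.
Qed.

End Component.

(** * Points of vertices *)

Section Vertices.
Context {R : realType} (B : board R) (P : rider).
Local Notation lv := (level P).
Local Notation bd := (boundary (region B)).
Local Notation s := (s_map B P).
Implicit Types (S C c : seq (R * R)) (T : run B P).

(** The stretch between two points of a path, traversed from index [i] and reversed when [j < i]. It
    serves to make a corner trajectory start at its corner. *)
Lemma sub_path r c i j : alt_path B P r c -> uniq c -> (forall a, a \in c -> bd a) ->
  (i < size c)%N -> (j < size c)%N ->
  exists r' c', [/\ alt_path B P r' c', uniq c', {subset c' <= c},
    (0 < size c')%N /\ nth 0 c' 0 = nth 0 c i & nth 0 c j \in c'].
Proof.
move=> cp uc cb ic jc; have [ij|ji] := leqP i j.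
  exists (r (+) odd i), (mkseq (fun k => nth 0 c (i + k)) (j - i).+1); split.
  - move=> k; rewrite size_mkseq => kj; rewrite !nth_mkseq ?(ltnW kj) // addnS -addbA -oddD.
    by apply: cp; lia.
  - apply/(mkseq_uniqP _ _) => k l; rewrite !inE => kj lj.
    move=> e; have : (i + k = i + l)%N by apply: (path_inj uc _ _ e); lia.
    by lia.
  - move=> a /mapP[k]; rewrite mem_iota => kj ->.
    have ikc : (i + k < size c)%N by lia.
    exact: mem_nth.
  - by rewrite size_mkseq nth_mkseq // addn0.
  - by apply/mapP; exists (j - i)%N; rewrite ?mem_iota ?subnKC //; lia.
exists (r (+) odd i.-1), (mkseq (fun k => nth 0 c (i - k)) (i - j).+1); split.
- move=> k; rewrite size_mkseq => kj; rewrite !nth_mkseq ?(ltnW kj) //.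
  have e : (i - k = (i - k.+1).+1)%N by lia.
  have -> : r (+) odd i.-1 (+) odd k = r (+) odd (i - k.+1).
    have -> : i.-1 = (i - k.+1 + k)%N by lia.
    by rewrite oddD addbA addbK.
  have eS : ((i - k.+1).+1 < size c)%N by lia.
  by rewrite e path_prev //; split=> // /esym; exact: (cp _ eS).2.
- apply/(mkseq_uniqP _ _) => k l; rewrite !inE => kj lj.
  move=> e; have : (i - k = i - l)%N by apply: (path_inj uc _ _ e); lia.
  by lia.
- move=> a /mapP[k]; rewrite mem_iota => kj ->.
  have ikc : (i - k < size c)%N by lia.
  exact: mem_nth.
- by rewrite size_mkseq nth_mkseq // subn0.
- by apply/mapP; exists (i - j)%N; rewrite ?mem_iota ?subKn //; lia.
Qed.

Section RigidConfig.
Variables (S : seq (R * R)) (q : nat).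
Hypotheses (BS : forall a, a \in S -> region B a) (rS : rigid B P S).

(** The fourth property expresses connectedness: a chord-closed set that meets the run contains it.
    Hence two such runs have the same points or none in common. *)
Lemma component_run b : b \in S -> bd b -> exists T,
  [/\ is_corner_trajectory T \/ is_rigid_cycle T,
      [/\ uniq (run_points T), {subset run_points T <= S}, b \in run_points T
        & forall a, a \in run_points T -> bd a],
      s_closed B P S (run_points T),
      forall C x, s_closed B P S C -> x \in run_points T -> x \in C ->
        {subset run_points T <= C}
    & forall a r, a \in run_points T -> crosses B P r a ->
        exists2 k, (k.+1 < size (augmentation T))%N &
        segment (nth 0 (augmentation T) k) (nth 0 (augmentation T) k.+1) =
        segment a (s r a)].
Proof.
move=> bS bb; have [r [c [cc ccl]]] := max_component P bS bb.
have [cp uc cS bc cb] := cc; have c0 : (0 < size c)%N by case: (c) bc.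
have [T [Tc _ aug cyc]] := alt_path_run cp c0 (path_boundary cb c0).
exists T; rewrite Tc; split=> //.
- case: (rigid_componentP BS rS cc ccl) => [[a ac ca]|[[oN e] rc _]]; [left | right].
    by split; [rewrite /is_trajectory Tc | exists a; rewrite ?Tc].
  split; last by rewrite Tc; apply/full_rankP.
  by apply: cyc => //; rewrite -nth_last.
- move=> C x Ccl /(nthP 0)[i ic <-] iC a /(nthP 0)[n nc <-].
  apply: (@range_propagate (fun m => nth 0 c m \in C) _ i _ ic iC n nc) => m mc.
  have mS : nth 0 c m \in S by rewrite cS ?mem_nth // ltnW.
  have mS1 : nth 0 c m.+1 \in S by rewrite cS ?mem_nth.
  split=> h.
    by rewrite (cp m mc).1; apply: Ccl => //; rewrite -(cp m mc).1.
  by rewrite -(path_prev cp cb mc); apply: Ccl => //; rewrite (path_prev cp cb mc).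
- by move=> a r' /(nthP 0)[i ic <-]; exact: aug.
Qed.

Lemma boundary_point_special b : (size S <= q)%N -> b \in S -> bd b ->
  (rigid_cycle_points B P q `|` corner_start_points B P q) b.
Proof.
move=> Sq bS bb; have [r [c [cc ccl]]] := max_component P bS bb.
have [cp uc cS bc cb] := cc; have c0 : (0 < size c)%N by case: (c) bc.
case: (rigid_componentP BS rS cc ccl) => [[a ac ca]|[[oN e] rc _]]; [right | left].
  move: ac bc ca => /(nthP 0)[i ic <-] /(nthP 0)[j jc <-] ci.
  have [r' [c' [cp' uc' c'c [c'0 c'i] jc']]] := sub_path cp uc cb ic jc.
  have bi : bd (nth 0 c' 0) by rewrite c'i; apply: cb; rewrite mem_nth.
  have [T [Tc Ts _ _]] := alt_path_run cp' c'0 bi.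
  exists T; rewrite Tc /starts_at_corner Ts c'i; split=> //.
    split; first by rewrite /is_trajectory Tc.
    by exists (nth 0 c i); rewrite // Tc -c'i mem_nth.
  rewrite -size_run_points Tc (leq_trans _ Sq) // uniq_leq_size // => x /c'c; exact: cS.
have [T [Tc _ _ cyc]] := alt_path_run cp c0 (path_boundary cb c0).
exists T; rewrite Tc; split=> //.
  split; last by rewrite Tc; apply/full_rankP.
  by apply: cyc => //; rewrite -nth_last.
by rewrite -size_run_points Tc (leq_trans _ Sq) // uniq_leq_size.
Qed.

(* Otherwise the points of S on the line of type r through x could be moved in
   the other direction. *)
Lemma interior_point_attacked x r : x \in S -> interior (region B) x ->
  exists a, [/\ a \in S, bd a & lv r a = lv r x].
Proof.
move=> xS ix; apply: contrapT => noa.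
pose f a r' := ((r' == r) && (lv r a == lv r x))%:R : R.
have [d dE] : exists d, forall a r', lv r' (d a) = f a r'.
  by exists (fun a => sval (cid (level_ex P (f a)))) => a; case: cid.
have fd : flex B P S d.
  split=> [r' a b aS bS ab|k a aS ak].
    by rewrite !dE /f; case: eqVneq => //= rr; rewrite -rr ab.
  rewrite (_ : d a = 0) ?dot0r //; apply: (@level_inj _ P) => r'; rewrite dE /f.
  case: eqVneq => //= _; case: eqVneq => //= ax; case: noa; exists a; split=> //.
  by apply/boundaryE; split; [exact: BS | exists k].
have := dE x r; rewrite (rS fd xS) level0 /f !eqxx /= => /eqP.
by rewrite eq_sym oner_eq0.
Qed.

(** One chord of each type through [x] starts at a boundary point of [S]. If their starting points
    lie in one component, [x] is a self-crossing; otherwise two disjoint components cross. As [x]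
    itself belongs to [S], at most [q.-1] points are left for the runs. *)
Lemma interior_point_special x : (size S <= q)%N -> x \in S -> interior (region B) x ->
  (self_crossings B P q `|` pair_crossings B P q) x.
Proof.
move=> Sq xS ix.
have [a [aS ba ax]] := interior_point_attacked false xS ix.
have [c [cS bc cx]] := interior_point_attacked true xS ix.
have cra : crosses B P false a by exists x.
have crc : crosses B P true c by exists x.
have xa : segment a (s false a) x by have [_ _ _ _] := s_map_chord ba cra; apply.
have xc : segment c (s true c) x by have [_ _ _ _] := s_map_chord bc crc; apply.
(* A point on both chords has both levels of [x]. *)
have meet : segment a (s false a) `&` segment c (s true c) = [set x].
  apply/seteqP; split=> [y [ya yc]|_ ->] //=.
  apply/eqP; rewrite -subr_eq0; apply/eqP/(@level_inj _ P) => -[]; rewrite levelB.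
    by rewrite (level_segment _ yc) ?level_s_map // cx subrr.
  by rewrite (level_segment _ ya) ?level_s_map // ax subrr.
have [T [spT [uT TS aT bT] Tcl Tconn augT]] := component_run aS ba.
have xT : x \notin run_points T.
  by apply/negP => /bT /boundary_not_interior.
have [i iT ei] := augT a false aT cra.
have [cT|cT] := boolP (c \in run_points T).
  left; have [j jT ej] := augT c true cT crc.
  exists T; split=> //; last first.
    by split=> //; exists i, j; split=> //; rewrite ei ej.
  have : (size (x :: run_points T) <= size S)%N.
    apply: uniq_leq_size; first by rewrite /= xT.
    by move=> y; rewrite inE => /predU1P[->|/TS].
  by rewrite /= size_run_points; lia.
right; have [T' [spT' [uT' TS' cT' bT'] _ Tconn' augT']] := component_run cS bc.
have [j jT ej] := augT' c true cT' crc.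
have xT' : x \notin run_points T'.
  by apply/negP => /bT' /boundary_not_interior.
have disj y : y \in run_points T' -> y \notin run_points T.
  by move=> yT'; apply: contra cT => yT; exact: (Tconn' _ _ Tcl yT' yT).
exists T, T'; split=> //.
- by move=> e; rewrite e cT' in cT.
- have : (size (x :: run_points T ++ run_points T') <= size S)%N.
    apply: uniq_leq_size.
      rewrite /= mem_cat negb_or xT xT' cat_uniq uT uT' /= andbT.
      by apply/hasPn => y /disj.
    by move=> y; rewrite inE mem_cat => /predU1P[->|/orP[/TS|/TS']].
  by rewrite /= size_cat !size_run_points; lia.
by split=> //; exists i, j; split=> //; rewrite ei ej.
Qed.

End RigidConfig.

Lemma vertex_point_special q (z : 'I_q -> R * R) i : is_vertex B P z ->
  (rigid_cycle_points B P q `|` corner_start_points B P q `|`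
    self_crossings B P q `|` pair_crossings B P q) (z i).
Proof.
move=> /vertexP[Bz rz]; have Bc a : a \in codom z -> region B a by move=> /codomP[j ->].
have cq : (size (codom z) <= q)%N by rewrite size_codom card_ord.
rewrite -setUA; have [iz|bz] := region_cases (Bz i).
  by right; apply: interior_point_special cq _ iz => //; exact: codom_f.
by left; apply: boundary_point_special cq _ bz => //; exact: codom_f.
Qed.

End Vertices.

(** * From points to denominators *)

(** The least common multiple depends only on the common multiples, so denominators of
    configurations may be replaced by those of their points. *)
Lemma eq_lcm_of (S S' : set nat) :
  (forall m, (forall n, S n -> (n %| m)%N) <-> (forall n, S' n -> (n %| m)%N)) ->
  lcm_of S = lcm_of S'.
Proof.
move=> SS'; apply: (@is_lcm_unique S); first exact: lcm_ofP.
have [ub lub] := lcm_ofP S'.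
by split=> [|m /SS']; [apply/SS' | exact: lub].
Qed.

Lemma dvdn_config_denominator (R : realType) (q : nat) (z : 'I_q -> R * R) m :
  (config_denominator z %| m)%N <-> forall i, (point_denominator (z i) %| m)%N.
Proof.
split=> [zm i|zm]; last first.
  by apply: (big_ind (fun d => d %| m)%N) => // x y xm ym; rewrite dvdn_lcm xm.
by apply: dvdn_trans zm; rewrite /config_denominator (bigD1 i) //= dvdn_lcml.
Qed.

Theorem theorem5p11 (R : realType) (B : board R) (P : rider) (q : nat)
    (q_ge1 : (1 <= q)%N) :
  polytope_denominator B P q =
  lcm_of [set point_denominator x | x in
    rigid_cycle_points B P q `|` corner_start_points B P q `|`
    self_crossings B P q `|` pair_crossings B P q].
Proof.
apply: eq_lcm_of => m; split=> [H _ [x /special_point_vertex[z [vz [i <-]]] <-]|H _ [z vz <-]].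
  by apply: (dvdn_config_denominator z m).1; apply: H; exists z.
apply/dvdn_config_denominator => i; apply: H.
by exists (z i) => //; exact: vertex_point_special.
Qed.
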